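(* Let $M_1,\ldots,M_s$ be $m\times m$ positive semidefinite matrices such that $\sum_{k=1}^sM_k$ has full rank $m$, let $N\ge1$ be an integer, let $p\in[0,1]$, and let $\boldsymbol{w}^*$ be an optimal solution of the continuous problem $$\max\Big\{\Phi_p\big(M_F(\boldsymbol{w})\big):\ \boldsymbol{w}\in\mathbb{R}_+^s,\ \sum_{k=1}^sw_k\le N\Big\}.$$ Then, for any subset $S$ of $[s]$, $$\frac1N\sum_{i\in S}(w_i^* )^{1-p}\ \le\ \frac{\varphi_p(S)}{\varphi_p(\boldsymbol{w}^* )}.$$
   Context: $[s]:=\{1,\ldots,s\}$; positive semidefinite matrices are real symmetric. For $\boldsymbol{w}\in\mathbb{R}_+^s$, $M_F(\boldsymbol{w}):=\sum_{i=1}^sw_iM_i$. For an $m\times m$ positive semidefinite matrix $M$ with eigenvalues $\lambda_1,\dots,\lambda_m$ (with multiplicities), $\operatorname{trace}M^p:=\sum_k\lambda_k^p$ if $p\in(0,1]$ and $\operatorname{trace}M^0:=\operatorname{rank}M$. The criterion is $\Phi_p(M)=\big(\frac1m\operatorname{trace}M^p\big)^{1/p}$ for $p\in(0,1]$, and $\Phi_0(M)=(\det M)^{1/m}$. Moreover $\varphi_p(\boldsymbol{w}):=\operatorname{trace}M_F(\boldsymbol{w})^p$ for $\boldsymbol{w}\in\mathbb{R}_+^s$, and $\varphi_p(S):=\operatorname{trace}\big(\sum_{i\in S}M_i\big)^p$ for $S\subseteq[s]$ (both are ranks when $p=0$). For scalar powers such as $(w_i^* )^{1-p}$ the convention $0^0=0$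 is adopted. *)

(* Defs.v *)
From HB Require Import structures.
From mathcomp Require Import all_boot all_order all_algebra.
From mathcomp Require Import polyrcf.
From mathcomp Require Import reals exp.

Set Implicit Arguments.
Unset Strict Implicit.
Unset Printing Implicit Defensive.

Import Order.TTheory GRing.Theory Num.Theory.

Local Open Scope ring_scope.

Section Defs.

Variable R : realType.

Definition psdmx (m : nat) (A : 'M[R]_m) : Prop :=
  A \is symmetricmx /\ forall x : 'cV[R]_m, 0 <= (x^T *m A *m x) 0 0.

(* Real eigenvalues listed with algebraic multiplicity; for a symmetric matrix
   these are all m of its eigenvalues. *)
Definition eigenvalues (m : nat) (A : 'M[R]_m) : seq R :=
  flatten [seq nseq (mup x (char_poly A)) x | x <- rootsR (char_poly A)].

(* trace A^p, as a function of the spectrum, with trace A^0 := rank A.  It is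
   meant for positive semidefinite A and p in [0, 1]. *)
Definition trace_pow (p : R) (m : nat) (A : 'M[R]_m) : R :=
  if p == 0 then (\rank A)%:R else \sum_(x <- eigenvalues A) x `^ p.

Definition Phi (p : R) (m : nat) (A : 'M[R]_m) : R :=
  if p == 0 then (\det A) `^ (m%:R^-1)
  else (m%:R^-1 * trace_pow p A) `^ (p^-1).

Definition info_mx (s m : nat) (M : 'I_s -> 'M[R]_m) (w : 'I_s -> R) : 'M[R]_m :=
  \sum_i w i *: M i.

Definition phi (p : R) (s m : nat) (M : 'I_s -> 'M[R]_m) (w : 'I_s -> R) : R :=
  trace_pow p (info_mx M w).

Definition phi_set (p : R) (s m : nat) (M : 'I_s -> 'M[R]_m)
    (S : {set 'I_s}) : R :=
  trace_pow p (\sum_(i in S) M i).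

Definition feasible (s N : nat) (w : 'I_s -> R) : Prop :=
  (forall i, 0 <= w i) /\ \sum_i w i <= N%:R.

Definition optimal (p : R) (s m N : nat) (M : 'I_s -> 'M[R]_m)
    (w : 'I_s -> R) : Prop :=
  feasible N w /\
  forall v, feasible N v -> Phi p (info_mx M v) <= Phi p (info_mx M w).

(* Real power with the convention 0^0 = 0, whereas 0 `^ 0 = 1. *)
Definition powRz (a x : R) : R := if a == 0 then 0 else a `^ x.

Lemma mem_eigenvalues (m : nat) (A : 'M[R]_m) (x : R) :
  (x \in eigenvalues A) = eigenvalue A x.
Proof.
have A0 : char_poly A != 0 by exact: monic_neq0 (char_poly_monic A).
have rE y : (y \in rootsR (char_poly A)) = root (char_poly A) y.
  by have /(_ y) := roots_on_rootsR A0; rewrite in_itv.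
rewrite eigenvalue_root_char; apply/flatten_mapP/idP => [[y yA]|xA].
  by rewrite mem_nseq => /andP[_ /eqP->]; rewrite -rE.
by exists x; rewrite ?rE// mem_nseq eqxx andbT -XsubC_dvd// dvdp_XsubCl.
Qed.

Lemma count_eigenvalues (m : nat) (A : 'M[R]_m) (x : R) :
  count_mem x (eigenvalues A) = mup x (char_poly A).
Proof.
have A0 : char_poly A != 0 by exact: monic_neq0 (char_poly_monic A).
have rE y : (y \in rootsR (char_poly A)) = root (char_poly A) y.
  by have /(_ y) := roots_on_rootsR A0; rewrite in_itv.
rewrite count_flatten -map_comp sumnE big_map.
under eq_bigr => y _ do rewrite /= count_nseq.
have [xA|xA] := boolP (root (char_poly A) x); last first.
  rewrite mupNroot// big1_seq// => y /andP[_]; rewrite rE => yA /=.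
  by have [e|] := eqVneq y x; rewrite ?mul0n//; rewrite -e yA in xA.
rewrite (bigD1_seq x) ?rE ?uniq_roots//= eqxx mul1n big1 ?addn0// => y yx.
by rewrite (negbTE yx).
Qed.

End Defs.

(* Main.v *)
(* Put X = M_F(w) and q = 1/p.  For 0 < p < 1 optimality forces X to be
   definite, and shifting weight away from an index i with w_i > 0 gives
     trace X^p / N <= trace (X^(p-1) M_i).
   It remains to bound the sum over i in S of w_i^(1-p) trace (X^(p-1) M_i) by
   trace (M_S^p).  Substituting w_i = u_i^q, that sum is a directional
   derivative of g(u) = trace ((sum_i u_i^q M_i)^p), which is homogeneous of
   degree 1, and the bound is the tangent inequality Dg(u)[v] <= g(v) with v
   constant on S and (nearly) zero off S; so it suffices that g is convex along
   segments.  In the eigenbasis (y_a) of Y = sum_i u_i^q M_i its second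
   derivative is controlled pairwise: with N the first-order variation, the
   Schur complement N Y^-1 N bounds the second-order one, and the sum of both
   contributions is nonnegative because
     (1-p)/2 (y_a^(p-1)/y_b + y_b^(p-1)/y_a)
        + (y_a^(p-1) - y_b^(p-1))/(y_a - y_b) >= 0,
   which reduces to (1-p) sinh x >= sinh ((1-p) x).  No derivative of a matrix
   function is taken: increments of trace (Y^(p-1) N) are written exactly as
   double sums over the eigenbases of the two endpoints, and the quadratic
   errors vanish as the segment is subdivided.
   For p = 0 determinants and AM-GM replace the trace of the power, and for
   p = 1 everything is linear. *)
Require Import Defs.
From HB Require Import structures.
From mathcomp Require Import all_boot all_order all_algebra.
From mathcomp Require Import complex boolp functions interval_inference reals normedtype derive exp.
From mathcomp Require Import ring lra zify.

Import Order.TTheory GRing.Theory Num.Theory.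
Import numFieldNormedType.Exports.

Local Open Scope ring_scope.

(** * The spectral theorem for real symmetric matrices *)

Definition spectral_dec {R : realType} {m : nat} (A Q : 'M[R]_m) (d : 'rV[R]_m) : Prop :=
  Q *m Q^T = 1%:M /\ A = Q^T *m diag_mx d *m Q.

Definition qform {R : realType} {m : nat} (A : 'M[R]_m) (x y : 'cV[R]_m) : R :=
  (x^T *m A *m y) 0 0.


(** Over the complex field [R[i]] an eigenvector [v] exists. Evaluating v A v^* from either side
    gives the eigenvalue and its conjugate as factors of v v^*, which is nonzero; so the eigenvalue
    is real, and it is already a root over [R]. *)
Lemma symmetric_real_eigenvalue (R : realType) (n : nat) (A : 'M[R]_n.+1) :
  A^T = A -> exists a, eigenvalue A a.
Proof.
move=> sA; pose f := real_complex R.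
have [a /eigenvalueP[v vA v0]] := @eigenvalue_closed R[i] n.+1 (map_mx f A) isT.
pose vc := map_mx (@conjc R) v.
have vcA : vc *m map_mx f A = (conjc a) *: vc.
  have := congr1 (map_mx (@conjc R)) vA; rewrite map_mxM map_mxZ /= => <-.
  congr (_ *m _); apply/matrixP => i j; rewrite !mxE.
  exact/esym/conjc_real.
have fAT : (map_mx f A)^T = map_mx f A by rewrite -{2}sA; apply/matrixP => i j; rewrite !mxE.
have vv0 : (v *m vc^T) 0 0 != 0.
  rewrite !mxE; apply/eqP => /psumr_eq0P h.
  case/negP: v0; apply/eqP/rowP => j; rewrite mxE.
  apply/eqP; rewrite -normr_eq0 -sqrf_eq0 normCK.
  have -> : v 0 j * (v 0 j)^* = v 0 j * vc^T j 0 by rewrite !mxE.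
  apply/eqP; apply: h => // i _.
  by rewrite !mxE; apply: mul_conjC_ge0.
have ra : conjc a = a.
  have e : v *m map_mx f A *m vc^T = a *: (v *m vc^T) by rewrite vA scalemxAl.
  have e' : v *m map_mx f A *m vc^T = conjc a *: (v *m vc^T).
    by rewrite -mulmxA -{1}fAT -trmx_mul vcA linearZ /= scalemxAr.
  move: e; rewrite e' => /matrixP /(_ 0 0).
  by rewrite [LHS]mxE [RHS]mxE => /(mulIf vv0).
exists (complex.Re a); rewrite eigenvalue_root_char.
have aE : a = f (complex.Re a).
  by move: ra; case: a {vA vcA} => x y /= [] ; rewrite /f /real_complex_def => hy; congr (_ +i* _)%C; lra.
have : root (char_poly (map_mx f A)) (f (complex.Re a)).
  by rewrite -aE -eigenvalue_root_char; apply/eigenvalueP; exists v.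
by rewrite -map_char_poly fmorph_root.
Qed.

Section RealSpectral.
Variable R : realType.

Lemma row_sqnorm_gt0 (n : nat) (v : 'rV[R]_n) : v != 0 -> 0 < (v *m v^T) 0 0.
Proof.
move=> v0; rewrite mxE lt_neqAle; apply/andP; split; last first.
  by apply: sumr_ge0 => j _; rewrite mxE -expr2 sqr_ge0.
rewrite eq_sym; apply/eqP => /psumr_eq0P h.
case/negP: v0; apply/eqP/rowP => j; rewrite mxE; apply/eqP.
rewrite -sqrf_eq0 expr2; apply/eqP; have := h _ j isT.
by rewrite mxE; apply => i _; rewrite mxE -expr2 sqr_ge0.
Qed.

(* A Householder reflection. *)
Lemma reflection_to_unit_row (n : nat) (u : 'rV[R]_n.+1) : (u *m u^T) 0 0 = 1 ->
  exists H : 'M[R]_n.+1, [/\ H^T = H, H *m H = 1%:M & delta_mx 0 0 *m H = u].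
Proof.
move=> u1; pose e : 'rV[R]_n.+1 := delta_mx 0 0.
have [ue|ue] := eqVneq u e.
  by exists 1%:M; rewrite trmx1 !mulmx1 ue.
have [z zE] : exists z, z = u - e by exists (u - e).
have z0 : z != 0 by rewrite zE subr_eq0.
have zz0 := row_sqnorm_gt0 _ _ z0; set t := (z *m z^T) 0 0 in zz0.
have ezE (y : 'rV[R]_n.+1) : e *m y^T = (y 0 0)%:M.
  by rewrite -rowE [LHS]mx11_scalar !mxE.
have zzE : z *m z^T = t%:M by rewrite [LHS]mx11_scalar.
have tE : t = 2 - 2 * u 0 0.
  rewrite /t zE linearB /= mulmxBl !mulmxBr !mxE.
  have -> : \sum_j u 0 j * u^T j 0 = 1 by rewrite -u1 mxE.
  have -> : \sum_j e 0 j * u^T j 0 = u 0 0 by have := ezE u => /matrixP/(_ 0 0); rewrite !mxE mulr1n.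
  have -> : \sum_j e 0 j * e^T j 0 = 1 by have := ezE e => /matrixP/(_ 0 0); rewrite !mxE mulr1n.
  have -> : \sum_j u 0 j * e^T j 0 = u 0 0.
    have := ezE u => /matrixP/(_ 0 0); rewrite !mxE mulr1n => <-.
    by apply: eq_bigr => j _; rewrite !mxE mulrC.
  ring.
have t0 : t != 0 by rewrite gt_eqF.
exists (1%:M - (2 / t) *: (z^T *m z)); split.
- by rewrite linearB /= linearZ /= trmx1 trmx_mul trmxK.
- rewrite mulmxBl mul1mx mulmxBr mulmx1 -scalemxAl -scalemxAr.
  rewrite mulmxA -(mulmxA z^T) zzE mul_mx_scalar -scalemxAl !scalerA.
  have -> : 2 / t * (2 / t * t) = 2 / t + 2 / t :> R by field.
  by rewrite scalerDl opprB addrK subrK.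
- rewrite mulmxBr mulmx1 -scalemxAr mulmxA ezE mul_scalar_mx scalerA.
  have -> : 2 / t * z 0 0 = -1.
    rewrite zE !mxE !eqxx /=; have : t != 0 by [].
    rewrite tE => h; field; exact: h.
  by rewrite scaleN1r opprK zE addrC subrK.
Qed.

(** Deflation: a reflection taking the first basis row to a unit eigenvector turns [A] into [B],
    whose first row is [a] times that basis row. Symmetry clears the first column as well, and
    induction diagonalises the remaining block. *)
Theorem spectral_theorem (m : nat) (A : 'M[R]_m) : A^T = A ->
  exists Q d, spectral_dec A Q d.
Proof.
elim: m A => [|n IHn] A sA.
  by exists 0, 0; split; apply/matrixP => -[].
have [a /eigenvalueP[v vA v0]] := symmetric_real_eigenvalue _ _ _ sA.
have vv0 := row_sqnorm_gt0 _ _ v0; set t := (v *m v^T) 0 0 in vv0.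
pose u := (Num.sqrt t)^-1 *: v.
have u1 : (u *m u^T) 0 0 = 1.
  rewrite /u linearZ /= -scalemxAl -scalemxAr scalerA mxE -/t.
  by rewrite -expr2 exprVn sqr_sqrtr ?ltW// mulVf// gt_eqF.
have uA : u *m A = a *: u by rewrite /u -scalemxAl vA !scalerA mulrC.
have [H [sH HH eH]] := reflection_to_unit_row _ _ u1.
have [B defB] : exists B : 'M[R]_(1 + n), B = H *m A *m H by exists (H *m A *m H).
have sB : B^T = B by rewrite defB !trmx_mul sH sA mulmxA.
have rB : delta_mx 0 0 *m B = a *: (delta_mx 0 0 : 'rV[R]_(1 + n)).
  rewrite defB !mulmxA eH uA -scalemxAl; congr (_ *: _).
  by rewrite -eH -mulmxA HH mulmx1.
have Brow j : B 0 j = a * (j == 0)%:R.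
  by have /matrixP/(_ 0 j) := rB; rewrite -rowE !mxE eqxx.
have ulB : ulsubmx B = a%:M.
  by apply/matrixP => i j; rewrite !ord1 !mxE !lshift0 Brow eqxx mulr1 mulr1n.
have urB : ursubmx B = 0.
  by apply/matrixP => i j; rewrite !ord1 !mxE !lshift0 Brow -(inj_eq val_inj) /= mulr0.
have dlB : dlsubmx B = 0.
  by rewrite -(trmxK (dlsubmx B)) trmx_dlsub sB urB trmx0.
have BE : B = block_mx a%:M 0 0 (drsubmx B).
  by rewrite -[LHS]submxK ulB urB dlB.
have [Q [d [QQ dE]]] : exists Q d, spectral_dec (drsubmx B) Q d.
  by apply: IHn; rewrite trmx_drsub sB.
pose P : 'M[R]_(1 + n) := block_mx 1%:M 0 0 Q.
have trP : P^T = block_mx 1%:M 0 0 Q^T by rewrite /P tr_block_mx trmx1 !trmx0.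
exists (P *m H), (row_mx a%:M d); split.
  rewrite trmx_mul sH -mulmxA (mulmxA H) HH mul1mx trP /P [LHS](@mulmx_block _ 1 n 1 n 1 n).
  by rewrite !mulmx0 !mul0mx !mulmx1 !addr0 !add0r QQ -scalar_mx_block.
have -> : A = H *m B *m H.
  by rewrite defB !mulmxA HH mul1mx -mulmxA HH mulmx1.
rewrite trmx_mul sH trP -!mulmxA; congr (_ *m _); rewrite !mulmxA; congr (_ *m _).
rewrite (@diag_mx_row _ n 1) /P (@mulmx_block _ 1 n 1 n 1 n) !mulmx0 !mul0mx mul1mx !addr0 add0r.
rewrite (@mulmx_block _ 1 n 1 n 1 n) !mulmx0 !mul0mx mulmx1 !addr0 add0r -dE {1}BE.
suff -> : diag_mx (a%:M : 'rV[R]_1) = a%:M by [].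
by apply/matrixP => i j; rewrite !ord1 !mxE eqxx !mulr1n.
Qed.

End RealSpectral.

(** * Spectral calculus *)

Section SpectralCalculus.
Variable R : realType.

Lemma rank_diag_mx (n : nat) (d : 'rV[R]_n) :
  \rank (diag_mx d) = (\sum_(a < n) (d 0%R a != 0%R))%N.
Proof.
elim: n d => [|n IHn] d; first by rewrite big_ord0 flatmx0 mxrank0.
have [l [r ->]] : exists (l : 'rV[R]_1) (r : 'rV[R]_n), d = row_mx l r.
  by exists (@lsubmx _ 1 1 n d), (@rsubmx _ 1 1 n d); rewrite hsubmxK.
rewrite (@diag_mx_row _ n 1) (@rank_diag_block_mx _ 1 1 n n).
rewrite IHn rank_rV big_ord_recl; congr (_ + _)%N.
  have -> : ord0 = lshift n (0 : 'I_1) by exact: val_inj.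
  rewrite (@row_mxEl _ 1 1 n); congr (nat_of_bool (~~ _)); apply/eqP/eqP => [/matrixP/(_ 0 0)|h].
    by rewrite !mxE !eqxx !mulr1n.
  by apply/matrixP => i j; rewrite !ord1 !mxE h mul0rn.
apply: eq_bigr => a _; congr (nat_of_bool (_ != _)).
have -> : lift ord0 a = rshift 1 a by exact: val_inj.
by rewrite (@row_mxEr _ 1 1 n).
Qed.

Variable m : nat.
Implicit Types (A N Q P Y Z : 'M[R]_m) (d x y : 'rV[R]_m).

Lemma spectral_dec_rank A Q d : spectral_dec A Q d ->
  \rank A = (\sum_(a < m) (d 0%R a != 0%R))%N.
Proof.
move=> [QQ ->]; have [Qu _] := mulmx1_unit QQ.
by rewrite mxrankMfree ?row_free_unit// eqmxMfull ?row_full_unit ?unitmx_tr// rank_diag_mx.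
Qed.

Lemma spectral_dec_char_poly A Q d : spectral_dec A Q d ->
  char_poly A = \prod_(a < m) ('X - (d 0 a)%:P).
Proof.
move=> [QQ ->]; have QQ' := mulmx1C QQ.
transitivity (char_poly (diag_mx d)); last first.
  rewrite char_poly_trig ?diag_mx_is_trig//.
  by apply: eq_bigr => a _; rewrite mxE eqxx mulr1n.
rewrite /char_poly /char_poly_mx.
have e : map_mx polyC Q^T *m map_mx polyC Q = 1%:M by rewrite -map_mxM QQ' map_mx1.
have -> : 'X%:M - map_mx polyC (Q^T *m diag_mx d *m Q) =
   map_mx polyC Q^T *m ('X%:M - map_mx polyC (diag_mx d)) *m map_mx polyC Q.
  by rewrite mulmxBr mulmxBl mul_mx_scalar -scalemxAl e scalemx1 !map_mxM.
rewrite !det_mulmx mulrAC -det_mulmx e det1 mul1r //.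
Qed.

Lemma spectral_dec_det A Q d : spectral_dec A Q d -> \det A = \prod_a d 0 a.
Proof.
move=> [QQ ->]; have QQ' := mulmx1C QQ.
by rewrite !det_mulmx mulrAC -det_mulmx QQ' det1 mul1r det_diag.
Qed.

(** Comparing multiplicities in the characteristic polynomial shows that [eigenvalues A] is a
    permutation of the entries of [d]. From here on any orthogonal diagonalisation can stand for the
    spectrum. *)
Lemma spectral_dec_trace_pow A Q d p : spectral_dec A Q d -> p != 0 ->
  trace_pow p A = \sum_a (d 0 a) `^ p.
Proof.
move=> dA p0; rewrite /trace_pow (negbTE p0).
transitivity (\sum_(x <- [seq d 0 a | a <- index_enum 'I_m]) x `^ p); last first.
  by rewrite big_map.
apply: perm_big; rewrite /perm_eq; apply/allP => x _ /=.
rewrite count_eigenvalues (spectral_dec_char_poly _ _ _ dA).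
by rewrite -(big_map (fun a => d 0 a) xpredT (fun c => 'X - c%:P)) mu_prod_XsubC.
Qed.

Lemma spectral_dec_form A Q d v : spectral_dec A Q d ->
  qform A v v = \sum_a d 0 a * ((Q *m v) a 0) ^+ 2.
Proof.
move=> [QQ ->]; rewrite /qform.
have -> : v^T *m (Q^T *m diag_mx d *m Q) *m v = (Q *m v)^T *m diag_mx d *m (Q *m v).
  by rewrite trmx_mul !mulmxA.
rewrite mxE; apply: eq_bigr => a _; rewrite mul_mx_diag !mxE; ring.
Qed.

Lemma spectral_dec_conj A Q d : spectral_dec A Q d -> Q *m A *m Q^T = diag_mx d.
Proof. by move=> [QQ ->]; rewrite !mulmxA QQ mul1mx -mulmxA QQ mulmx1. Qed.

Lemma qform_row N Q P a b : qform N (Q^T *m delta_mx a 0) (P^T *m delta_mx b 0) = (Q *m N *m P^T) a b.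
Proof.
rewrite /qform trmx_mul trmxK trmx_delta !mulmxA -colE.
by rewrite -!mulmxA -rowE !mxE.
Qed.

Lemma spectral_dec_eigenvalue A Q d a : spectral_dec A Q d ->
  d 0 a = (Q *m A *m Q^T) a a.
Proof. by move/spectral_dec_conj ->; rewrite mxE eqxx mulr1n. Qed.

(* [\tr (f(A) *m N)] when [spectral_dec A Q d]. *)
Definition spectral_trace (f : R -> R) Q d N : R :=
  \sum_a f (d 0 a) * (Q *m N *m Q^T) a a.

Lemma spectral_traceD f Q d N N' :
  spectral_trace f Q d (N + N') = spectral_trace f Q d N + spectral_trace f Q d N'.
Proof.
rewrite -big_split; apply: eq_bigr => a _.
by rewrite mulmxDr mulmxDl mxE mulrDr.
Qed.

Lemma spectral_traceZ f Q d c N :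
  spectral_trace f Q d (c *: N) = c * spectral_trace f Q d N.
Proof.
rewrite mulr_sumr; apply: eq_bigr => a _.
by rewrite -scalemxAr -scalemxAl mxE mulrCA.
Qed.

Lemma spectral_traceB f Q d N N' :
  spectral_trace f Q d (N - N') = spectral_trace f Q d N - spectral_trace f Q d N'.
Proof. by rewrite -(scaleN1r N') spectral_traceD spectral_traceZ mulN1r. Qed.

Lemma spectral_trace_sum f Q d (I : finType) (D : {pred I}) (F : I -> 'M[R]_m) :
  spectral_trace f Q d (\sum_(i in D) F i) = \sum_(i in D) spectral_trace f Q d (F i).
Proof.
apply: (big_morph _ (spectral_traceD f Q d)).
by rewrite -(scale0r 0) spectral_traceZ mul0r.
Qed.

Lemma spectral_trace_self f A Q d : spectral_dec A Q d ->
  spectral_trace f Q d A = \sum_a f (d 0 a) * d 0 a.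
Proof. by move=> dA; apply: eq_bigr => a _; rewrite -(spectral_dec_eigenvalue _ _ _ _ dA). Qed.

(** Inserting P^T P = 1 spreads the trace over a second orthonormal basis. When [P] is an eigenbasis
    of another matrix, the two spectra can be compared entry by entry. *)
Lemma spectral_trace_orth f Q d P N : P *m P^T = 1%:M ->
  spectral_trace f Q d N =
    \sum_a \sum_b f (d 0 a) * (Q *m N *m P^T) a b * (Q *m P^T) a b.
Proof.
move=> PP; apply: eq_bigr => a _.
have -> : Q *m N *m Q^T = (Q *m N *m P^T) *m (Q *m P^T)^T.
  by rewrite trmx_mul trmxK -!mulmxA (mulmxA P^T) (mulmx1C PP) mul1mx.
rewrite [in LHS]mxE mulr_sumr; apply: eq_bigr => b _.
by rewrite [(_^T) b a]mxE mulrA.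
Qed.

Lemma spectral_trace_orth_sym f Q d P N : P *m P^T = 1%:M -> N^T = N ->
  spectral_trace f Q d N =
    \sum_a \sum_b f (d 0 b) * (P *m N *m Q^T) a b * (P *m Q^T) a b.
Proof.
move=> PP sN; rewrite (spectral_trace_orth _ _ _ _ _ PP) exchange_big.
apply: eq_bigr => a _; apply: eq_bigr => b _.
congr (_ * _ * _); last by rewrite -[in RHS](trmxK P) -trmx_mul [RHS]mxE.
have -> : Q *m N *m P^T = (P *m N *m Q^T)^T by rewrite !trmx_mul trmxK sN mulmxA.
by rewrite [LHS]mxE.
Qed.

Lemma orthogonal_row_sqsum (O : 'M[R]_m) a : O *m O^T = 1%:M -> \sum_b O a b ^+ 2 = 1.
Proof.
move=> /matrixP/(_ a a); rewrite !mxE eqxx mulr1n => <-.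
by apply: eq_bigr => b _; rewrite mxE expr2.
Qed.

Lemma orthogonal_col_sqsum (O : 'M[R]_m) b : O *m O^T = 1%:M -> \sum_a O a b ^+ 2 = 1.
Proof.
move=> /mulmx1C OO; rewrite -(orthogonal_row_sqsum O^T b) ?trmxK//.
by apply: eq_bigr => a _; rewrite mxE.
Qed.

Lemma orthogonal_mul Q P : Q *m Q^T = 1%:M -> P *m P^T = 1%:M ->
  (Q *m P^T) *m (Q *m P^T)^T = 1%:M.
Proof.
by move=> QQ PP; rewrite trmx_mul trmxK mulmxA -(mulmxA Q) (mulmx1C PP) mulmx1.
Qed.

Lemma mixed_left Y Q x P a b : spectral_dec Y Q x ->
  (Q *m Y *m P^T) a b = x 0 a * (Q *m P^T) a b.
Proof. by move=> [QQ ->]; rewrite !mulmxA QQ mul1mx -mulmxA mul_diag_mx mxE. Qed.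

Lemma mixed_right Z P y Q a b : spectral_dec Z P y ->
  (Q *m Z *m P^T) a b = y 0 b * (Q *m P^T) a b.
Proof.
move=> [PP ->]; rewrite !mulmxA -[_ *m P *m P^T]mulmxA PP mulmx1 mul_mx_diag mxE; exact: mulrC.
Qed.

(* The junk value 0 on the diagonal [s = t] is harmless in
   [spectral_trace_diff], where the corresponding term vanishes anyway. *)
Definition divided_difference (f : R -> R) (s t : R) : R := (f s - f t) / (s - t).

(* The double operator sum of Daletskii-Krein and Loewner. *)
Lemma spectral_trace_diff f Y Z Q x P y N :
  spectral_dec Y Q x -> spectral_dec Z P y -> N^T = N ->
  spectral_trace f Q x N - spectral_trace f P y N =
  \sum_a \sum_b divided_difference f (x 0 a) (y 0 b) *
     (Q *m (Y - Z) *m P^T) a b * (Q *m N *m P^T) a b.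
Proof.
move=> dY dZ sN; have [QQ _] := dY; have [PP _] := dZ.
rewrite (spectral_trace_orth _ _ _ _ _ PP) (spectral_trace_orth_sym _ _ _ _ _ QQ sN).
rewrite -sumrB; apply: eq_bigr => a _; rewrite -sumrB; apply: eq_bigr => b _.
(* The mixed entry of [Y - Z] is x_a - y_b times the entry of Q P^T, so it cancels the denominator
   of the divided difference. *)
have -> : (Q *m (Y - Z) *m P^T) a b = (Q *m Y *m P^T) a b - (Q *m Z *m P^T) a b.
  by rewrite mulmxBr mulmxBl [LHS]mxE; congr (_ + _); rewrite mxE.
rewrite (mixed_left _ _ _ _ _ _ dY) (mixed_right _ _ _ _ _ _ dZ) /divided_difference.
have [->|xy] := eqVneq (x 0 a) (y 0 b); first by rewrite !subrr !mul0r.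
by field; rewrite subr_eq0.
Qed.

End SpectralCalculus.

(** * Real powers *)

Section RealPowers.
Variable R : realType.
Implicit Types (x y z p r K : R).

Lemma powR_ndecr r x y : 0 <= r -> 0 <= x -> x <= y -> x `^ r <= y `^ r.
Proof.
by move=> r0 x0 xy; apply: (ge0_ler_powR r0); rewrite ?nnegrE// (le_trans x0).
Qed.

Lemma powR_nincr r x y : r <= 0 -> 0 < x -> x <= y -> y `^ r <= x `^ r.
Proof.
move=> r0 x0 xy; have y0 := lt_le_trans x0 xy.
rewrite -(opprK r) !(powRN _ (- r)) lef_pV2 ?posrE ?powR_gt0//.
by rewrite powR_ndecr ?oppr_ge0// ltW.
Qed.

Lemma powR_MVT r x y : 0 < x -> x <= y ->
  exists c, x <= c <= y /\ y `^ r - x `^ r = r * c `^ (r - 1) * (y - x).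
Proof.
move=> x0 xy; case: (@MVT_segment R (@powR R ^~ r) (fun c => r * c `^ (r - 1)) x y xy) => [c| |c].
- by rewrite in_itv /= => /andP[xc _]; apply: is_derive1_powR; exact: lt_trans xc.
- apply: derivable_within_continuous => c; rewrite in_itv /= => /andP[xc _].
  by apply: derivable_powR; rewrite in_itv /= andbT (lt_le_trans x0).
- by rewrite in_itv /= => ? ?; exists c.
Qed.

Lemma powR_lipschitz r K x y : 0 < x -> 0 < y ->
  (forall c, Num.min x y <= c <= Num.max x y -> c `^ (r - 1) <= K) ->
  `|x `^ r - y `^ r| <= `|r| * K * `|x - y|.
Proof.
move=> + + hK; wlog xy : x y hK / x <= y => [hw x0 y0|x0 y0].
  have [xy|yx] := leP x y; first exact: hw.
  rewrite distrC (distrC x); apply: hw => //; last exact: ltW.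
  by rewrite minC maxC.
have [c [cxy e]] := powR_MVT r _ _ x0 xy.
rewrite distrC e (distrC x) !normrM ler_wpM2r// ler_wpM2l//.
by rewrite ger0_norm ?powR_ge0// hK// (min_idPl xy) (max_idPr xy).
Qed.

Lemma powR_bounded (a b r : R) : 0 < a ->
  exists2 K, 0 <= K & forall c, a <= c <= b -> c `^ r <= K.
Proof.
move=> a0; have [r0|r0] := leP r 0.
  by exists (a `^ r); rewrite ?powR_ge0// => c /andP[ac _]; exact: powR_nincr.
exists (b `^ r); rewrite ?powR_ge0// => c /andP[ac cb].
have c0 := lt_le_trans a0 ac.
by rewrite powR_ndecr// ltW.
Qed.

Lemma powR_lipschitz_itv (a b r : R) : 0 < a ->
  exists2 K, 0 <= K & forall x y, a <= x <= b -> a <= y <= b ->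
    `|x `^ r - y `^ r| <= K * `|x - y|.
Proof.
move=> a0; have [K K0 hK] := powR_bounded _ b (r - 1) a0.
exists (`|r| * K) => [|x y /andP[ax xb] /andP[ay yb]]; first by rewrite mulr_ge0.
apply: powR_lipschitz => [||c /andP[h1 h2]]; first exact: lt_le_trans ax.
  exact: lt_le_trans ay.
apply: hK; apply/andP; split; first by apply: le_trans h1; rewrite le_min ax.
by apply: (le_trans h2); rewrite ge_max xb.
Qed.

(** The increment equals the derivative at an intermediate [c] times y - x; since |c - x| <= |y -
    x|, the Lipschitz bound on the derivative makes the remainder quadratic. *)
Lemma powR_taylor_itv (a b r : R) : 0 < a ->
  exists2 K, 0 <= K & forall x y, a <= x <= b -> a <= y <= b ->
    `|y `^ r - x `^ r - r * x `^ (r - 1) * (y - x)| <= K * (y - x) ^+ 2.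
Proof.
move=> a0; have [K K0 hK] := powR_lipschitz_itv _ b (r - 1) a0.
exists (`|r| * K) => [|x y /andP[ax xb] /andP[ay yb]]; first by rewrite mulr_ge0.
have x0 := lt_le_trans a0 ax; have y0 := lt_le_trans a0 ay.
have [c [ac cb cx ->]] : exists c, [/\ a <= c, c <= b, `|c - x| <= `|y - x|
    & y `^ r - x `^ r = r * c `^ (r - 1) * (y - x)].
  have [xy|/ltW yx] := leP x y.
    have [c [/andP[xc cy] ->]] := powR_MVT r _ _ x0 xy.
    exists c; split=> //; [exact: le_trans xc|exact: le_trans yb|].
    by rewrite !ger0_norm ?subr_ge0// lerB.
  have [c [/andP[yc cx] e]] := powR_MVT r _ _ y0 yx.
  exists c; split; [exact: le_trans yc|exact: le_trans xb| |].
    by rewrite !(distrC _ x) !ger0_norm ?subr_ge0// lerB.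
  by rewrite -opprB e -mulrN opprB.
rewrite -mulrBl -mulrBr !normrM -(real_normK (num_real (y - x))) expr2 mulrA.
rewrite ler_wpM2r// -mulrA ler_wpM2l//.
apply: le_trans (hK c x _ _) _; rewrite ?ac ?ax//.
by rewrite ler_wpM2l.
Qed.

Lemma powR_concave_tangent p x z : 0 <= p <= 1 -> 0 < x -> 0 <= z ->
  z `^ p <= x `^ p + p * x `^ (p - 1) * (z - x).
Proof.
move=> /andP[p0 p1] x0; have p10 : p - 1 <= 0 by rewrite subr_le0.
rewrite le_eqVlt => /orP[/eqP <-|z0].
  (* The point z = 0 lies outside the mean value argument. For p > 0 the claim becomes (1 - p) x^p
     >= 0; for p = 0 both powers are 1, that of 0 included. *)
  have -> : x `^ p + p * x `^ (p - 1) * (0 - x) = x `^ p - p * (x * x `^ (p - 1)) by ring.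
  have [->|pn0] := eqVneq p 0; first by rewrite !powRr0; lra.
  rewrite powR0// mulr_powRB1 ?(ltW x0)//; last by rewrite lt_neqAle eq_sym pn0.
  have -> : x `^ p - p * x `^ p = (1 - p) * x `^ p by ring.
  by rewrite mulr_ge0 ?powR_ge0 ?subr_ge0.
have [xz|/ltW zx] := leP x z.
  have [c [/andP[xc _] e]] := powR_MVT p _ _ x0 xz.
  rewrite -lerBlDl e ler_wpM2r ?subr_ge0// ler_wpM2l//.
  exact: powR_nincr.
have [c [/andP[zc cx] e]] := powR_MVT p _ _ z0 zx.
rewrite -lerBlDl -(opprB (x `^ p)) e -(opprB x) mulrN lerN2 ler_wpM2r ?subr_ge0// ler_wpM2l//.
by apply: powR_nincr; rewrite // (lt_le_trans z0).
Qed.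

Lemma powR_subadd p x y : 0 < p -> p <= 1 -> 0 <= x -> 0 <= y -> (x + y) `^ p <= x `^ p + y `^ p.
Proof.
move=> p0 p1; rewrite le_eqVlt => /orP[/eqP <- _|x0].
  by rewrite add0r powR0 ?gt_eqF// add0r.
rewrite le_eqVlt => /orP[/eqP <-|y0].
  by rewrite addr0 powR0 ?gt_eqF// addr0.
have xy0 := addr_gt0 x0 y0; have p10 : p - 1 <= 0 by rewrite subr_le0.
rewrite -(mulr_powRB1 (ltW x0) p0) -(mulr_powRB1 (ltW y0) p0) -(mulr_powRB1 (ltW xy0) p0) mulrDl.
by apply: lerD; apply: ler_wpM2l (ltW _) _ _ _ => //; apply: powR_nincr => //; rewrite ?lerDl ?lerDr ltW.
Qed.

(* [t sinh x >= sinh (t x)] for [0 <= t <= 1], with [s = expR x]. *)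
Lemma powR_sinh (t s : R) : 0 <= t <= 1 -> 1 <= s ->
  s `^ t - s `^ (- t) <= t * (s - s `^ (-1)).
Proof.
move=> /andP[t0 t1] s1.
pose g : R -> R := (t *: (id - @powR R ^~ (-1)) - @powR R ^~ t + @powR R ^~ (- t))%R.
pose dg (c : R) : R := t *: (1 - (-1) * c `^ (-1 - 1)) - t * c `^ (t - 1) + (- t) * c `^ (- t - 1).
have hd (c : R) : 0 < c -> is_derive c 1 g (dg c).
  move=> c0; rewrite /g /dg.
  have d1 := is_derive_id c (1 : R).
  have d2 a : is_derive c (1 : R) (@powR R ^~ a) (a * c `^ (a - 1)) by exact: is_derive1_powR.
  exact: (is_deriveD (is_deriveB (is_deriveZ t (is_deriveB d1 (d2 (-1)))) (d2 t)) (d2 (- t))).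
have [c| |c] := @MVT_segment R g dg 1 s s1.
- by rewrite in_itv /= => /andP[c1 _]; apply: hd; exact: lt_trans c1.
- apply: derivable_within_continuous => c; rewrite in_itv /= => /andP[c1 _].
  by have [] := hd c (lt_le_trans ltr01 c1).
rewrite in_itv /= => /andP[c1 _].
have c0 := lt_le_trans ltr01 c1.
have g1 : g 1 = 0 by rewrite /g /= !fctE /= !powR1 subrr scaler0; lra.
rewrite g1 subr0 /g !fctE /= => e.
have : 0 <= dg c * (s - 1).
  rewrite mulr_ge0 ?subr_ge0// /dg.
  (* The derivative factors as t (1 - c^(t-1)) (1 - c^(-t-1)), and both exponents are nonpositive
     while c >= 1. *)
  have -> : -1 - 1 = (t - 1) + (- t - 1) :> R by ring.
  rewrite powRD; last by rewrite (gt_eqF c0) implybT.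
  have h r : r <= 0 -> c `^ r <= 1.
    by move=> r0; have := powR_nincr _ _ _ r0 ltr01 c1; rewrite powR1.
  have h1 := h (t - 1); have h2 := h (- t - 1).
  have -> : t *: (1 - -1 * (c `^ (t - 1) * c `^ (- t - 1))) - t * c `^ (t - 1) + - t * c `^ (- t - 1)
     = t * ((1 - c `^ (t - 1)) * (1 - c `^ (- t - 1))) by rewrite /GRing.scale /=; ring.
  by rewrite !mulr_ge0 ?subr_ge0// ?h1 ?h2//; lra.
rewrite -e /GRing.scale /=; lra.
Qed.

(** By symmetry x >= y. With x = y s^2 and a = s^p, the divided difference is a positive factor
    times a^2 - s^2. The sinh inequality bounds s^2 - a^2 by (1 - p) a (s^2 - 1), and 2 a <= a^2 + 1
    turns this into the first summand. *)
Lemma powR_divided_difference p x y : 0 < p < 1 -> 0 < x -> 0 < y ->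
  0 <= (1 - p) / 2 * (x `^ (p - 1) / y + y `^ (p - 1) / x)
       + divided_difference _ (@powR R ^~ (p - 1)) x y.
Proof.
move=> /andP[p0 p1]; wlog yx : x y / y <= x => [hw x0 y0|x0 y0].
  have [/hw|/ltW xy] := leP y x; first exact.
  have := hw _ _ xy y0 x0; congr (0 <= _ * _ + _); first exact: addrC.
  by rewrite /divided_difference /= -[in RHS](opprB (y `^ (p - 1))) -[in RHS](opprB y) invrN mulrNN.
have x10 : 0 <= x `^ (p - 1) / y + y `^ (p - 1) / x.
  by apply: addr_ge0; apply: divr_ge0; rewrite ?powR_ge0 ?ltW.
(* On the diagonal the divided difference takes its default value 0, and only the nonnegative first
   summand remains. *)
rewrite /divided_difference; have [->|xy] := eqVneq x y.
  rewrite subrr mul0r addr0; apply: mulr_ge0; first by lra.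
  by apply: addr_ge0; apply: divr_ge0; rewrite ?powR_ge0 ?ltW.
have xy0 : 0 < x - y by rewrite subr_gt0 lt_neqAle eq_sym xy.
pose s := Num.sqrt (x / y).
have s1 : 1 <= s.
  have : Num.sqrt 1 <= s by apply: ler_wsqrtr; rewrite ler_pdivlMr// mul1r.
  by rewrite sqrtr1.
have s0 := lt_le_trans ltr01 s1.
have xE : x = y * s ^+ 2.
  by rewrite sqr_sqrtr ?divr_ge0 ?ltW// mulrCA divff ?mulr1// gt_eqF.
have sn a b : s `^ (a + b) = s `^ a * s `^ b by rewrite powRD// (gt_eqF s0) implybT.
pose a := s `^ p; pose b := s `^ (- p).
have ab : a * b = 1 by rewrite -sn subrr powRr0.
have a0 : 0 < a by rewrite powR_gt0.
have b0 : 0 < b by rewrite powR_gt0.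
have xp : x `^ (p - 1) = y `^ (p - 1) * (a ^+ 2 / s ^+ 2).
  rewrite xE powRM ?ltW ?exprn_gt0//; congr (_ * _).
  transitivity (s `^ (p + p + (-1 + -1))).
    by rewrite -powR_mulrn ?(ltW s0)// -powRrM; congr (_ `^ _); ring.
  by rewrite !sn -/a powR_inv1 ?(ltW s0)//; field; rewrite gt_eqF.
have := powR_sinh (1 - p) s; rewrite s1 => /(_ _ isT).
have -> : (0 <= 1 - p <= 1) by apply/andP; split; lra.
move=> /(_ isT).
have -> : - (1 - p) = p + -1 by ring.
rewrite !sn -/a -/b powRr1 ?(ltW s0)// powR_inv1 ?(ltW s0)//.
move=> h.
rewrite /= xp; set Y := y `^ (p - 1).
have Y0 : 0 < Y by rewrite powR_gt0.
have s2 : 0 < s ^+ 2 - 1.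
  move: xy0; rewrite xE -{2}[y]mulr1 -mulrBr pmulr_rgt0//.
have h' : s ^+ 2 - a ^+ 2 <= (1 - p) * a * (s ^+ 2 - 1).
  have -> : s ^+ 2 - a ^+ 2 = s * a * (s * b - a / s).
    have -> : s * a * (s * b - a / s) = s ^+ 2 * (a * b) - a ^+ 2 * (s / s) by ring.
    by rewrite ab divff ?gt_eqF// !mulr1.
  have -> : (1 - p) * a * (s ^+ 2 - 1) = s * a * ((1 - p) * (s - s^-1)).
    by field; rewrite gt_eqF.
  by rewrite ler_wpM2l// mulr_ge0 ?ltW.
have h2 : (1 - p) * a * (s ^+ 2 - 1) <= (1 - p) / 2 * (a ^+ 2 + 1) * (s ^+ 2 - 1).
  rewrite ler_wpM2r ?(ltW s2)// -mulrA; apply: ler_wpM2l; first by lra.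
  by have := sqr_ge0 (a - 1); rewrite sqrrB1; lra.
have -> : (1 - p) / 2 * (Y * (a ^+ 2 / s ^+ 2) / y + Y / x)
    + (Y * (a ^+ 2 / s ^+ 2) - Y) / (x - y) =
  Y / (y * s ^+ 2 * (s ^+ 2 - 1)) *
   ((1 - p) / 2 * (a ^+ 2 + 1) * (s ^+ 2 - 1) - (s ^+ 2 - a ^+ 2)).
  rewrite xE; field; rewrite !gt_eqF //.
  by move: xy0; rewrite xE.
apply: mulr_ge0; first by rewrite divr_ge0 ?ltW// !mulr_gt0 ?exprn_gt0.
by rewrite subr_ge0 (le_trans h').
Qed.

End RealPowers.

(** * Norm bounds and quadratic forms *)

Section EntryNorm.
Variables (R : realType) (m : nat).
Implicit Types (A N Q P Y Z : 'M[R]_m) (d x y : 'rV[R]_m) (v : 'cV[R]_m).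

(** The entrywise l1 norm. Entries of orthogonal matrices are at most 1 in absolute value, so it
    bounds every entry of Q N P^T uniformly in the orthogonal [Q] and [P]. *)
Definition entry_norm N : R := \sum_k \sum_l `|N k l|.

Lemma entry_norm_ge0 N : 0 <= entry_norm N.
Proof. by apply: sumr_ge0 => k _; apply: sumr_ge0. Qed.

Lemma orthogonal_entry_le1 (O : 'M[R]_m) a b : O *m O^T = 1%:M -> `|O a b| <= 1.
Proof.
move=> OO; rewrite -(@ler_pXn2r _ 2)// ?nnegrE// expr1n real_normK ?num_real//.
rewrite -(orthogonal_row_sqsum _ _ _ a OO) (bigD1 b)//= lerDl.
by apply: sumr_ge0 => ? _; exact: sqr_ge0.
Qed.

Lemma mixed_entry_le Q P N a b : Q *m Q^T = 1%:M -> P *m P^T = 1%:M ->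
  `|(Q *m N *m P^T) a b| <= entry_norm N.
Proof.
move=> QQ PP; rewrite mxE (le_trans (ler_norm_sum _ _ _))// /entry_norm exchange_big.
apply: ler_sum => l _; rewrite mxE normrM.
rewrite (le_trans (ler_wpM2l _ (_ : _ <= 1)))//.
  by rewrite mxE; apply: orthogonal_entry_le1.
rewrite mulr1 (le_trans (ler_norm_sum _ _ _))//.
apply: ler_sum => k _; rewrite normrM ler_piMl//; exact: orthogonal_entry_le1.
Qed.

Lemma entry_norm_sum (I : finType) (c : I -> R) (F : I -> 'M[R]_m) (K : R) :
  (forall i, `|c i| <= K) ->
  entry_norm (\sum_i c i *: F i) <= K * \sum_i entry_norm (F i).
Proof.
move=> hK; rewrite mulr_sumr /entry_norm.
under eq_bigr => k _ do under eq_bigr => l _ do rewrite summxE.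
apply: (@le_trans _ _ (\sum_k \sum_l \sum_i K * `|F i k l|)).
  apply: ler_sum => k _; apply: ler_sum => l _.
  rewrite (le_trans (ler_norm_sum _ _ _))//; apply: ler_sum => i _.
  by rewrite mxE normrM ler_wpM2r.
rewrite [leRHS](_ : _ = \sum_k \sum_l \sum_i K * `|F i k l|)//.
transitivity (\sum_i \sum_k \sum_l K * `|F i k l|).
  by apply: eq_bigr => i _; rewrite mulr_sumr; apply: eq_bigr => k _; rewrite mulr_sumr.
rewrite exchange_big; apply: eq_bigr => k _; exact: exchange_big.
Qed.

Lemma spectral_trace_bound f Q d N (K : R) : Q *m Q^T = 1%:M ->
  (forall a, `|f (d 0 a)| <= K) ->
  `|spectral_trace R m f Q d N| <= m%:R * (K * entry_norm N).
Proof.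
move=> QQ hK; rewrite (le_trans (ler_norm_sum _ _ _))//.
rewrite (_ : m%:R * _ = \sum_(a < m) K * entry_norm N); last first.
  by rewrite sumr_const card_ord mulr_natl.
apply: ler_sum => a _; rewrite normrM; apply: ler_pM => //.
exact: mixed_entry_le.
Qed.

Lemma double_sum_bound (g : 'I_m -> 'I_m -> R) Q P Y N (K : R) :
  Q *m Q^T = 1%:M -> P *m P^T = 1%:M -> (forall a b, `|g a b| <= K) ->
  `|\sum_a \sum_b g a b * (Q *m Y *m P^T) a b * (Q *m N *m P^T) a b| <=
    m%:R ^+ 2 * (K * entry_norm Y * entry_norm N).
Proof.
move=> QQ PP hK; rewrite (le_trans (ler_norm_sum _ _ _))//.
rewrite (_ : m%:R ^+ 2 * _ =
    \sum_(a < m) \sum_(b < m) K * entry_norm Y * entry_norm N); last first.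
  by rewrite !sumr_const card_ord expr2 -mulrA !mulr_natl.
apply: ler_sum => a _; rewrite (le_trans (ler_norm_sum _ _ _))//.
apply: ler_sum => b _; rewrite !normrM; apply: ler_pM => //.
by apply: ler_pM => //; exact: mixed_entry_le.
exact: mixed_entry_le.
Qed.

Lemma spectral_trace_lipschitz f Y Z Q x P y N (K : R) :
  spectral_dec Y Q x -> spectral_dec Z P y -> N^T = N ->
  (forall a b, `|divided_difference R f (x 0 a) (y 0 b)| <= K) ->
  `|spectral_trace R m f Q x N - spectral_trace R m f P y N| <=
    m%:R ^+ 2 * (K * entry_norm (Y - Z) * entry_norm N).
Proof.
move=> dY dZ sN hK; rewrite (spectral_trace_diff _ _ _ _ _ _ _ _ _ _ dY dZ sN).
by apply: (double_sum_bound (fun a b => divided_difference R f (x 0 a) (y 0 b))) => //; [case: dY|case: dZ].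
Qed.

(** In the double sum for two decompositions of one matrix the factor [Y - Y] vanishes. Eigenbases
    may therefore be chosen arbitrarily. *)
Lemma spectral_trace_unique f Y Q x P y N :
  spectral_dec Y Q x -> spectral_dec Y P y -> N^T = N ->
  spectral_trace R m f Q x N = spectral_trace R m f P y N.
Proof.
move=> dY dZ sN; apply/eqP; rewrite -subr_eq0.
rewrite (spectral_trace_diff _ _ _ _ _ _ _ _ _ _ dY dZ sN) subrr.
rewrite big1// => a _; rewrite big1// => b _.
by rewrite mulmx0 mul0mx mxE mulr0 mul0r.
Qed.

End EntryNorm.

Section Forms.
Variables (R : realType) (m : nat).
Implicit Types (A B N Q P X Y Z : 'M[R]_m) (d x y z : 'rV[R]_m) (v w : 'cV[R]_m).

Lemma qformDl A B v w : qform (A + B) v w = qform A v w + qform B v w.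
Proof. by rewrite /qform mulmxDr mulmxDl mxE. Qed.

Lemma qform0l v w : qform (0 : 'M[R]_m) v w = 0.
Proof. by rewrite /qform mulmx0 mul0mx mxE. Qed.

Lemma qformZl c A v w : qform (c *: A) v w = c * qform A v w.
Proof. by rewrite /qform -scalemxAr -scalemxAl mxE. Qed.

Lemma qform_suml (I : finType) (D : {pred I}) (F : I -> 'M[R]_m) v w :
  qform (\sum_(i in D) F i) v w = \sum_(i in D) qform (F i) v w.
Proof.
apply: (big_morph (fun A => qform A v w)) => [A B|]; first exact: qformDl.
by rewrite -(scale0r 0) qformZl mul0r.
Qed.

Lemma qform_sym A v w : A^T = A -> qform A v w = qform A w v.
Proof.
move=> sA; rewrite /qform -[in RHS]sA.
have -> : w^T *m A^T *m v = (v^T *m A *m w)^T by rewrite !trmx_mul trmxK mulmxA.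
by rewrite [RHS]mxE.
Qed.

Lemma qformDr A v w w' : qform A v (w + w') = qform A v w + qform A v w'.
Proof. by rewrite /qform mulmxDr mxE. Qed.

Lemma qformZr c A v w : qform A v (c *: w) = c * qform A v w.
Proof. by rewrite /qform -scalemxAr mxE. Qed.

Lemma qform_comb A (b c : R) v w : A^T = A ->
  qform A (b *: v + c *: w) (b *: v + c *: w) =
  b ^+ 2 * qform A v v + 2 * (b * c) * qform A v w + c ^+ 2 * qform A w w.
Proof.
move=> sA; rewrite qformDr !qformZr !(qform_sym _ (_ + _) _ sA) !qformDr !qformZr.
by rewrite (qform_sym _ w v sA); ring.
Qed.

Lemma psdmx_sym A : psdmx A -> A^T = A.
Proof.
case; rewrite is_hermitianmxE => /eqP e _; rewrite [RHS]e expr0 scale1r.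
by apply/matrixP => i j; rewrite !mxE.
Qed.

Lemma psdmx_form A v : psdmx A -> 0 <= qform A v v.
Proof. by move=> [_ /(_ v)]. Qed.

Lemma psdmxP A : A^T = A -> (forall v, 0 <= qform A v v) -> psdmx A.
Proof.
move=> sA hA; split=> //; rewrite is_hermitianmxE expr0 scale1r -{1}sA; apply/eqP.
by apply/matrixP => i j; rewrite !mxE.
Qed.

Lemma psdmx_sum (I : finType) (D : {pred I}) (c : I -> R) (F : I -> 'M[R]_m) :
  (forall i, i \in D -> 0 <= c i) -> (forall i, psdmx (F i)) -> psdmx (\sum_(i in D) c i *: F i).
Proof.
move=> c0 hF; apply: psdmxP => [|v].
  by rewrite linear_sum; apply: eq_bigr => i _; rewrite linearZ /= psdmx_sym.
rewrite qform_suml; apply: sumr_ge0 => i iD; rewrite qformZl mulr_ge0 ?c0//.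
exact: psdmx_form.
Qed.

Lemma spectral_dec_ge A Q d (t : R) a : spectral_dec A Q d ->
  (forall v, t * qform 1%:M v v <= qform A v v) -> t <= d 0 a.
Proof.
move=> dA /(_ (Q^T *m delta_mx a 0)); rewrite !qform_row.
rewrite -(spectral_dec_eigenvalue _ _ _ _ _ _ dA) mulmx1.
by case: dA => -> _; rewrite mxE eqxx mulr1.
Qed.

Lemma psdmx_eigenvalue_ge0 A Q d a : psdmx A -> spectral_dec A Q d -> 0 <= d 0 a.
Proof.
move=> pA dA; apply: (spectral_dec_ge _ _ _ _ _ dA) => v.
by rewrite mul0r psdmx_form.
Qed.

Lemma spectral_dec_form_ge A Q d (t : R) v : spectral_dec A Q d ->
  (forall a, t <= d 0 a) -> t * qform 1%:M v v <= qform A v v.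
Proof.
move=> dA hd; rewrite (spectral_dec_form _ _ _ _ _ _ dA).
have [QQ _] := dA.
have -> : qform 1%:M v v = \sum_a ((Q *m v) a 0) ^+ 2.
  rewrite /qform mulmx1 -[v^T]mulmx1 -(mulmx1C QQ) -mulmxA -mulmxA mulmxA -trmx_mul.
  by rewrite mxE; apply: eq_bigr => a _; rewrite mxE expr2.
by rewrite mulr_sumr; apply: ler_sum => a _; rewrite ler_wpM2r ?sqr_ge0.
Qed.

(* Klein's inequality for the concave function [t |-> t ^ p]. *)
Lemma trace_power_tangent p X Z Q x P z : 0 <= p <= 1 ->
  spectral_dec X Q x -> spectral_dec Z P z ->
  (forall a, 0 < x 0 a) -> (forall b, 0 <= z 0 b) ->
  \sum_b z 0 b `^ p <=
  \sum_a x 0 a `^ p + p * spectral_trace R m (fun t => t `^ (p - 1)) Q x (Z - X).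
Proof.
move=> p01 dX dZ x0 z0; have [QQ _] := dX; have [PP _] := dZ.
set O := Q *m P^T; have OO : O *m O^T = 1%:M by exact: orthogonal_mul.
(* The squared entries of the orthogonal [O] are doubly stochastic weights; the scalar tangent
   inequality is averaged against them. *)
have -> : \sum_b z 0 b `^ p = \sum_a \sum_b O a b ^+ 2 * z 0 b `^ p.
  rewrite exchange_big; apply: eq_bigr => b _.
  by rewrite -mulr_suml orthogonal_col_sqsum// mul1r.
have -> : \sum_a x 0 a `^ p = \sum_a \sum_b O a b ^+ 2 * x 0 a `^ p.
  by apply: eq_bigr => a _; rewrite -mulr_suml orthogonal_row_sqsum// mul1r.
rewrite (spectral_trace_orth _ _ _ _ _ _ _ PP) mulr_sumr -big_split /=.
apply: ler_sum => a _; rewrite mulr_sumr -big_split /=; apply: ler_sum => b _.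
have -> : (Q *m (Z - X) *m P^T) a b = (z 0 b - x 0 a) * O a b.
  rewrite mulmxBr mulmxBl mxE (mixed_right _ _ _ _ _ _ _ _ dZ) mulrBl; congr (_ + _).
  by rewrite mxE (mixed_left _ _ _ _ _ _ _ _ dX).
rewrite -/O; have := powR_concave_tangent _ _ _ _ p01 (x0 a) (z0 b).
move=> /(ler_wpM2l (sqr_ge0 (O a b))) /le_trans; apply.
by rewrite le_eqVlt; apply/orP; left; apply/eqP; ring.
Qed.

End Forms.

(** * Convexity along segments *)

Section InfoMx.
Variables (R : realType) (s m : nat) (M : 'I_s -> 'M[R]_m).
Implicit Types (c : 'I_s -> R).

Lemma info_mxB c c' : info_mx M c - info_mx M c' = info_mx M (fun i => c i - c' i).
Proof. by rewrite /info_mx -sumrB; apply: eq_bigr => i _; rewrite scalerBl. Qed.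

Lemma info_mxD c c' : info_mx M c + info_mx M c' = info_mx M (fun i => c i + c' i).
Proof. by rewrite /info_mx -big_split; apply: eq_bigr => i _; rewrite /= scalerDl. Qed.

Lemma info_mxZ k c : k *: info_mx M c = info_mx M (fun i => k * c i).
Proof. by rewrite /info_mx scaler_sumr; apply: eq_bigr => i _; rewrite scalerA. Qed.

Lemma info_mx_form c v w : qform (info_mx M c) v w = \sum_i c i * qform (M i) v w.
Proof. by rewrite /info_mx qform_suml; apply: eq_bigr => i _; rewrite qformZl. Qed.

Hypothesis hM : forall i, psdmx (M i).

Lemma info_mx_sym c : (info_mx M c)^T = info_mx M c.
Proof.
by rewrite /info_mx linear_sum; apply: eq_bigr => i _; rewrite linearZ /= psdmx_sym.
Qed.

Lemma info_mx_le c c' v : (forall i, c i <= c' i) ->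
  qform (info_mx M c) v v <= qform (info_mx M c') v v.
Proof.
move=> cc; rewrite !info_mx_form; apply: ler_sum => i _.
by rewrite ler_wpM2r// psdmx_form.
Qed.

Lemma info_mx_psd c : (forall i, 0 <= c i) -> psdmx (info_mx M c).
Proof. by move=> c0; apply: psdmx_sum. Qed.

(** Index [i] contributes g_i times the form of [M i] at b_i v + c_i w, which is nonnegative. This
    is the semidefiniteness of a two by two block matrix. *)
Lemma info_mx_block (g b c : 'I_s -> R) v w : (forall i, 0 <= g i) ->
  0 <= qform (info_mx M (fun i => g i * b i ^+ 2)) v v
     + 2 * qform (info_mx M (fun i => g i * (b i * c i))) v w
     + qform (info_mx M (fun i => g i * c i ^+ 2)) w w.
Proof.
move=> g0; rewrite !info_mx_form mulr_sumr -!big_split; apply: sumr_ge0 => i _ /=.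
have := mulr_ge0 (g0 i) (psdmx_form _ _ _ (b i *: v + c i *: w) (hM i)).
by rewrite qform_comb ?psdmx_sym//; congr (0 <= _); ring.
Qed.

(* A Schur complement estimate: [N Z^-1 N <= L] when the block matrix with
   rows [Y N] and [N L] is positive semidefinite and [Y <= Z]. *)
Lemma schur_complement_bound (g b c : 'I_s -> R) (Z P Q : 'M[R]_m) y a :
  (forall i, 0 <= g i) -> spectral_dec Z P y -> (forall k, 0 < y 0 k) ->
  (forall v, qform (info_mx M (fun i => g i * b i ^+ 2)) v v <= qform Z v v) ->
  \sum_k (P *m info_mx M (fun i => g i * (b i * c i)) *m Q^T) k a ^+ 2 / y 0 k <=
  (Q *m info_mx M (fun i => g i * c i ^+ 2) *m Q^T) a a.
Proof.
move=> g0 dZ y0 hYZ.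
set N := info_mx M (fun i => g i * (b i * c i)).
pose n k := (P *m N *m Q^T) k a.
pose w : 'cV[R]_m := Q^T *m delta_mx a 0.
(* In the eigenbasis of [Z] these are the coordinates of -Z^-1 N w, the minimiser over v of v^T Z v
   + 2 v^T N w. *)
pose cf : 'cV[R]_m := \col_k (- n k / y 0 k).
have Pcf : P *m (P^T *m cf) = cf by case: dZ => PP _; rewrite mulmxA PP mul1mx.
have := info_mx_block g b c (P^T *m cf) w g0.
move/le_trans => /(_ _ (lerD (lerD (hYZ _) (lexx _)) (lexx _))).
rewrite qform_row (spectral_dec_form _ _ _ _ _ _ dZ) Pcf -/N.
have -> : qform N (P^T *m cf) w = \sum_k - (n k ^+ 2 / y 0 k).
  have -> : qform N (P^T *m cf) w = (cf^T *m (P *m N *m Q^T *m (delta_mx a 0 : 'cV[R]_m))) 0 0.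
    by rewrite /qform trmx_mul trmxK /w !mulmxA.
  rewrite mxE; apply: eq_bigr => k _; rewrite -colE [(_^T) _ _]mxE [cf _ _]mxE [col _ _ _ _]mxE -/(n k); ring.
have -> : \sum_k y 0 k * cf k 0 ^+ 2 = \sum_k n k ^+ 2 / y 0 k.
  by apply: eq_bigr => k _; rewrite mxE; field; rewrite gt_eqF.
rewrite sumrN; lra.
Qed.

End InfoMx.

(** A discrete form of the fact that a nondecreasing derivative [theta] of [psi] gives psi 1 - psi 0
    >= theta 0. With n equal steps the n quadratic errors add up to order 1/n. *)
Lemma le_of_small_steps (R : realType) (psi theta : R -> R) (C : R) : 0 <= C ->
  (forall s t, 0 <= s -> s <= t -> t <= 1 ->
     (t - s) * theta t - C * (t - s) ^+ 2 <= psi t - psi s) ->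
  (forall s t, 0 <= s -> s <= t -> t <= 1 ->
     - (C * (t - s) ^+ 2) <= theta t - theta s) ->
  theta 0 <= psi 1 - psi 0.
Proof.
move=> C0 hpsi htheta.
have main n : (0 < n)%N -> theta 0 - 2 * C / n%:R <= psi 1 - psi 0.
  move=> n0; have nR : 0 < n%:R :> R by rewrite ltr0n.
  set e : R := n%:R^-1; have e0 : 0 < e by rewrite invr_gt0.
  have en : n%:R * e = 1 by rewrite divff ?gt_eqF.
  have ink k : (k < n)%N -> [/\ 0 <= k%:R * e, k%:R * e <= k.+1%:R * e, k.+1%:R * e <= 1
      & k.+1%:R * e - k%:R * e = e].
    move=> kn; rewrite -[k.+1%:R]natr1 mulrDl mul1r; split.
    - by rewrite mulr_ge0 ?ler0n ?(ltW e0).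
    - by rewrite lerDl ltW.
    - have : k.+1%:R * e <= n%:R * e by rewrite ler_pM2r// ler_nat.
      by rewrite en -natr1 mulrDl mul1r.
    - by ring.
  have th k : (k <= n)%N -> theta 0 - k%:R * (C * e ^+ 2) <= theta (k%:R * e).
    elim: k => [|k IHk] kn; first by rewrite !mul0r subr0.
    have [h1 h2 h3 h4] := ink k kn.
    have := htheta _ _ h1 h2 h3; rewrite h4.
    have := IHk (ltnW kn); rewrite -[k.+1%:R]natr1 mulrDl mul1r; lra.
  have thn k : (k <= n)%N -> theta 0 - C * e <= theta (k%:R * e).
    move=> kn; apply: le_trans (th k kn); rewrite lerD2l lerN2.
    have -> : k%:R * (C * e ^+ 2) = C * e * (k%:R * e) by ring.
    rewrite ler_piMr ?mulr_ge0 ?(ltW e0)//.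
    have : k%:R * e <= n%:R * e by rewrite ler_pM2r// ler_nat.
    by rewrite en.
  have ps k : (k <= n)%N ->
      k%:R * (e * (theta 0 - C * e) - C * e ^+ 2) <= psi (k%:R * e) - psi 0.
    elim: k => [|k IHk] kn; first by rewrite !mul0r subrr.
    have [h1 h2 h3 h4] := ink k kn.
    have := hpsi _ _ h1 h2 h3; rewrite h4.
    have := ler_wpM2l (ltW e0) (thn _ kn).
    have := IHk (ltnW kn); rewrite -[k.+1%:R]natr1 [(k%:R + 1) * _]mulrDl mul1r; lra.
  (* One C/n comes from the drift of [theta] below [theta 0], another from the errors in the
     increments of [psi]. *)
  have := ps n (leqnn n); rewrite en; apply: le_trans.
  have -> : n%:R * (e * (theta 0 - C * e) - C * e ^+ 2)
     = (n%:R * e) * (theta 0 - 2 * C * e) by ring.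
  by rewrite en mul1r.
rewrite leNgt; apply/negP => hlt.
set d := theta 0 - (psi 1 - psi 0); have d0 : 0 < d by rewrite subr_gt0.
have h0 : 0 <= 2 * C / d by rewrite divr_ge0 ?(ltW d0)// mulr_ge0.
have := archi_boundP h0; set n := Num.bound _ => hn.
have n0 : 0 < n%:R :> R by exact: le_lt_trans hn.
have := main n; rewrite -(ltr0n R) n0 => /(_ isT).
move: hn; rewrite ltr_pdivrMr// (mulrC n%:R) -ltr_pdivrMr// /d; lra.
Qed.

Lemma eq_info_mx (R : realType) (s m : nat) (M : 'I_s -> 'M[R]_m) (c c' : 'I_s -> R) :
  c =1 c' -> info_mx M c = info_mx M c'.
Proof. by move=> e; apply: eq_bigr => i _; rewrite e. Qed.

Lemma divided_difference_powR_bound (R : realType) (r t x y : R) :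
  r <= 1 -> 0 < t -> t <= x -> t <= y ->
  `|divided_difference R (fun z => z `^ r) x y| <= `|r| * t `^ (r - 1).
Proof.
move=> r1 t0 tx ty; rewrite /divided_difference.
have [->|xy] := eqVneq x y; first by rewrite subrr mul0r normr0 mulr_ge0 ?powR_ge0.
rewrite normrM normfV ler_pdivrMr ?normr_gt0 ?subr_eq0//.
apply: powR_lipschitz => [||c /andP[hc _]]; [exact: lt_le_trans tx|exact: lt_le_trans ty|].
apply: powR_nincr; rewrite ?subr_le0//.
by apply: le_trans hc; rewrite le_min tx.
Qed.

Section ConvexPath.
Variables (R : realType) (s m : nat) (M : 'I_s -> 'M[R]_m).
Hypothesis hM : forall i, psdmx (M i).
Variable p : R.
Hypotheses (p0 : 0 < p) (p1 : p < 1).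
Variables (u h : 'I_s -> R) (lo t0 : R).
Hypotheses (lo0 : 0 < lo) (hu : forall i, lo <= u i) (hh : forall i, 0 <= h i).

(** Formally Y' = q N and N' = (q - 1) L. Since p q = 1, the derivative of the trace of Y^p is the
    trace of Y^(p-1) N, that is, [spectral_trace] of [f] at [N]. *)
Let q := p^-1.
Let U (t : R) i := u i + t * h i.
Let Y t := info_mx M (fun i => U t i `^ q).
Let N t := info_mx M (fun i => U t i `^ (q - 1) * h i).
Let L t := info_mx M (fun i => U t i `^ (q - 1 - 1) * h i ^+ 2).
Let f : R -> R := fun z => z `^ (p - 1).

Hypotheses (t0_gt0 : 0 < t0) (hY0 : forall v, t0 * qform 1%:M v v <= qform (Y 0) v v).

Let q1 : 1 < q.
Proof. by rewrite /q invf_gt1. Qed.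

Let q0 : 0 < q. Proof. exact: lt_trans q1. Qed.

Let hi := \sum_i (u i + h i).

Let u0 i : 0 < u i. Proof. exact: lt_le_trans (hu i). Qed.

Let uh_hi i : u i + h i <= hi.
Proof.
rewrite /hi (bigD1 i)//= lerDl; apply: sumr_ge0 => j _.
by rewrite addr_ge0// ltW.
Qed.

Let h_hi i : h i <= hi.
Proof. by apply: le_trans (uh_hi i); rewrite lerDr ltW. Qed.

Let U_itv t i : 0 <= t -> t <= 1 -> lo <= U t i <= hi.
Proof.
move=> t_ge0 t1; rewrite /U; apply/andP; split.
  by rewrite (le_trans (hu i))// lerDl mulr_ge0.
by apply: le_trans (uh_hi i); rewrite lerD2l ler_piMl.
Qed.

Let U_gt0 t i : 0 <= t -> 0 < U t i.
Proof. by move=> t_ge0; rewrite /U ltr_wpDr// mulr_ge0. Qed.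

Let U_diff t r i : U t i - U r i = (t - r) * h i.
Proof. by rewrite /U; ring. Qed.

Let Y_ndecr r t v : 0 <= r -> r <= t -> qform (Y r) v v <= qform (Y t) v v.
Proof.
move=> r0 rt; apply: info_mx_le => // i; apply: powR_ndecr; first exact: ltW.
  by rewrite ltW// U_gt0.
by rewrite -subr_ge0 U_diff mulr_ge0// subr_ge0.
Qed.

(** Since [h] is nonnegative, the path only increases, and the spectral lower bound [t0] at time 0
    holds throughout; this keeps the negative powers of eigenvalues bounded. *)
Let Y_eigenvalue_ge t Q x a : 0 <= t -> spectral_dec (Y t) Q x -> t0 <= x 0 a.
Proof.
move=> t_ge0 dY; apply: (spectral_dec_ge _ _ _ _ _ _ _ dY) => v.
by apply: le_trans (hY0 v) _; exact: Y_ndecr.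
Qed.

(** With the common factor U^(q-2) the coefficients become U^2, U h and h^2, the pattern that
    [schur_complement_bound] expects. *)
Let Y_block t : 0 <= t ->
  [/\ Y t = info_mx M (fun i => U t i `^ (q - 1 - 1) * U t i ^+ 2),
      N t = info_mx M (fun i => U t i `^ (q - 1 - 1) * (U t i * h i)) &
      L t = info_mx M (fun i => U t i `^ (q - 1 - 1) * h i ^+ 2)].
Proof.
move=> t_ge0; have e i r : U t i `^ r = U t i * U t i `^ (r - 1).
  rewrite -{2}(powRr1 (ltW (U_gt0 t i t_ge0))) -powRD ?subrKC//.
  by rewrite (gt_eqF (U_gt0 t i t_ge0)) implybT.
split=> //; apply: eq_info_mx => i.
  by rewrite (e i q) (e i (q - 1)); ring.
by rewrite (e i (q - 1)); ring.
Qed.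

(* Up to the factor [t - r], the right-hand side is the first-order part of the
   increment of [spectral_trace f _ _ (N _)] between [r] and [t]. *)
Let gradient_form_ge0 r t Q x P y : 0 <= r -> r <= t ->
  spectral_dec (Y t) Q x -> spectral_dec (Y r) P y ->
  0 <= q * (\sum_a \sum_b divided_difference R f (x 0 a) (y 0 b) *
              (Q *m N r *m P^T) a b * (Q *m N r *m P^T) a b)
     + (q - 1) / 2 * (spectral_trace R m f Q x (L r) + spectral_trace R m f P y (L r)).
Proof.
move=> r0 rt dQ dP.
have t_ge0 := le_trans r0 rt.
have x0 a : 0 < x 0 a := lt_le_trans t0_gt0 (Y_eigenvalue_ge _ _ _ a t_ge0 dQ).
have y0 b : 0 < y 0 b := lt_le_trans t0_gt0 (Y_eigenvalue_ge _ _ _ b r0 dP).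
have [eY eN eL] := Y_block r r0.
have g0 i : 0 <= U r i `^ (q - 1 - 1) by exact: powR_ge0.
pose n a b := (Q *m N r *m P^T) a b.
have nT a b : (P *m N r *m Q^T) b a = n a b.
  have -> : P *m N r *m Q^T = (Q *m N r *m P^T)^T.
    by rewrite !trmx_mul trmxK mulmxA info_mx_sym.
  by rewrite mxE.
have h1 : \sum_a \sum_b f (x 0 a) * (n a b ^+ 2 / y 0 b) <= spectral_trace R m f Q x (L r).
  apply: ler_sum => a _; rewrite -mulr_sumr ler_wpM2l ?powR_ge0//.
  have := schur_complement_bound _ _ _ _ hM _ (U r) h (Y r) P Q y a g0 dP y0.
  rewrite -eN -eL -eY; under eq_bigr => b _ do rewrite nT.
  by apply.
(* The mirror estimate takes the Schur complement with respect to [Y t], which dominates [Y r]. *)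
have h2 : \sum_a \sum_b f (y 0 b) * (n a b ^+ 2 / x 0 a) <= spectral_trace R m f P y (L r).
  rewrite exchange_big; apply: ler_sum => b _; rewrite -mulr_sumr ler_wpM2l ?powR_ge0//.
  have := schur_complement_bound _ _ _ _ hM _ (U r) h (Y t) Q P x b g0 dQ x0.
  by rewrite -eN -eL -eY; apply => v; exact: Y_ndecr.
apply: le_trans (_ : 0 <= q * (\sum_a \sum_b divided_difference R f (x 0 a) (y 0 b) * n a b * n a b)
   + (q - 1) / 2 * (\sum_a \sum_b f (x 0 a) * (n a b ^+ 2 / y 0 b)
     + \sum_a \sum_b f (y 0 b) * (n a b ^+ 2 / x 0 a))) _; last first.
  rewrite lerD2l ler_wpM2l ?lerD//.
  by rewrite divr_ge0// subr_ge0 ltW.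
(* Since q - 1 = q (1 - p), each term is q n_ab^2 times the scalar expression of
   [powR_divided_difference]. *)
rewrite -big_split !mulr_sumr -big_split; apply: sumr_ge0 => a _ /=.
rewrite -big_split !mulr_sumr -big_split; apply: sumr_ge0 => b _ /=.
have := powR_divided_difference _ p (x 0 a) (y 0 b).
rewrite p0 p1 => /(_ isT (x0 a) (y0 b)) hk.
have := mulr_ge0 (mulr_ge0 (ltW q0) (sqr_ge0 (n a b))) hk.
have qp : q * p = 1 by rewrite mulVf// gt_eqF.
have -> : q - 1 = q * (1 - p) by rewrite mulrBr mulr1 qp.
rewrite -/f; congr (0 <= _); rewrite /f; ring.
Qed.

Let B := \sum_i entry_norm R m (M i).

Let B0 : 0 <= B.
Proof. by apply: sumr_ge0 => i _; exact: entry_norm_ge0. Qed.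

Let norm_info (c : 'I_s -> R) (K : R) : (forall i, `|c i| <= K) ->
  entry_norm R m (info_mx M c) <= K * B.
Proof. exact: entry_norm_sum. Qed.

Let hi0 : 0 <= hi.
Proof. by apply: sumr_ge0 => i _; rewrite addr_ge0// ltW. Qed.

Let norm_h i : `|h i| <= hi. Proof. by rewrite ger0_norm. Qed.

Let norm_U_diff r t i : r <= t -> `|U t i - U r i| <= hi * (t - r).
Proof.
move=> rt; rewrite U_diff normrM (ger0_norm (_ : 0 <= t - r)) ?subr_ge0// mulrC.
by rewrite ler_wpM2r// subr_ge0.
Qed.

Let Y_lip : exists2 K, 0 <= K & forall r t, 0 <= r -> r <= t -> t <= 1 ->
  entry_norm R m (Y t - Y r) <= K * (t - r).
Proof.
have [K K0 hK] := powR_lipschitz_itv _ lo hi q lo0.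
exists (K * hi * B) => [|r t r0 rt t1]; first by rewrite !mulr_ge0.
rewrite info_mxB mulrAC; apply: norm_info => i.
have r1 := le_trans rt t1; have t_ge0 := le_trans r0 rt.
apply: le_trans (hK _ _ (U_itv t i t_ge0 t1) (U_itv r i r0 r1)) _.
by rewrite -mulrA ler_wpM2l// norm_U_diff.
Qed.

(** Either order of [r] and [t] is allowed: [value_step] expands backwards from [t], [gradient_step]
    forwards from [r]. *)
Let Y_taylor : exists2 K, 0 <= K & forall r t, 0 <= r -> r <= 1 -> 0 <= t -> t <= 1 ->
  entry_norm R m (Y t - Y r - (q * (t - r)) *: N r) <= K * (t - r) ^+ 2.
Proof.
have [K K0 hK] := powR_taylor_itv _ lo hi q lo0.
exists (K * hi ^+ 2 * B) => [|r t r0 r1 t_ge0 t1].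
  by rewrite !mulr_ge0// exprn_ge0.
rewrite info_mxZ !info_mxB mulrAC; apply: norm_info => i.
have := hK _ _ (U_itv r i r0 r1) (U_itv t i t_ge0 t1); rewrite U_diff.
have -> : q * U r i `^ (q - 1) * ((t - r) * h i) = q * (t - r) * (U r i `^ (q - 1) * h i) by ring.
move/le_trans; apply; rewrite -mulrA ler_wpM2l// exprMn mulrC ler_wpM2r ?sqr_ge0//.
by rewrite ler_pXn2r ?nnegrE.
Qed.

Let N_taylor : exists2 K, 0 <= K & forall r t, 0 <= r -> r <= t -> t <= 1 ->
  entry_norm R m (N t - N r - ((q - 1) * (t - r)) *: L r) <= K * (t - r) ^+ 2.
Proof.
have [K K0 hK] := powR_taylor_itv _ lo hi (q - 1) lo0.
exists (hi * (K * hi ^+ 2) * B) => [|r t r0 rt t1].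
  by rewrite !mulr_ge0// exprn_ge0.
rewrite info_mxZ !info_mxB mulrAC; apply: norm_info => i.
have r1 := le_trans rt t1; have t_ge0 := le_trans r0 rt.
have := hK _ _ (U_itv r i r0 r1) (U_itv t i t_ge0 t1); rewrite U_diff => hT.
have -> : U t i `^ (q - 1) * h i - U r i `^ (q - 1) * h i
   - (q - 1) * (t - r) * (U r i `^ (q - 1 - 1) * h i ^+ 2)
  = h i * (U t i `^ (q - 1) - U r i `^ (q - 1)
     - (q - 1) * U r i `^ (q - 1 - 1) * ((t - r) * h i)) by ring.
rewrite normrM -(mulrA hi); apply: ler_pM => //; apply: le_trans hT _.
rewrite -mulrA ler_wpM2l// exprMn mulrC ler_wpM2r ?sqr_ge0//.
by rewrite ler_pXn2r ?nnegrE.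
Qed.

Let NL_bound : exists2 K, 0 <= K & forall r, 0 <= r -> r <= 1 ->
  entry_norm R m (N r) <= K /\ entry_norm R m (L r) <= K.
Proof.
have [K K0 hK] := powR_bounded _ lo hi (q - 1) lo0.
have [K' K'0 hK'] := powR_bounded _ lo hi (q - 1 - 1) lo0.
exists (K * hi * B + K' * hi ^+ 2 * B) => [|r r0 r1].
  by rewrite addr_ge0// !mulr_ge0// exprn_ge0.
split.
  rewrite ler_wpDr ?mulr_ge0 ?exprn_ge0//; apply: norm_info => i.
  by rewrite normrM ler_pM// ger0_norm ?powR_ge0// hK// U_itv.
rewrite ler_wpDl ?mulr_ge0 ?exprn_ge0//; apply: norm_info => i.
rewrite normrM ler_pM// ?ger0_norm ?powR_ge0 ?exprn_ge0//; first by rewrite hK'// U_itv.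
by rewrite ler_pXn2r ?nnegrE.
Qed.

Let kf := t0 `^ (p - 1).
Let kd := `|p - 1| * t0 `^ (p - 1 - 1).

Let f_bound z : t0 <= z -> `|f z| <= kf.
Proof.
by move=> tz; rewrite ger0_norm ?powR_ge0// powR_nincr// subr_le0 ltW.
Qed.

Let kd_bound y z : t0 <= y -> t0 <= z -> `|divided_difference R f y z| <= kd.
Proof.
move=> ty tz; apply: divided_difference_powR_bound => //.
by rewrite lerBlDr (le_trans (ltW p1)) ?lerDl.
Qed.

(** Klein's inequality, with tangent point [Y t], bounds the trace power of [Y r] from above. Hence
    the derivative appears at the right endpoint, and the error comes only from the Taylor remainder
    of [Y]. *)
Let value_step : exists2 K, 0 <= K & forall r t Q x, 0 <= r -> r <= t -> t <= 1 ->
  spectral_dec (Y t) Q x ->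
  (t - r) * spectral_trace R m f Q x (N t) - K * (t - r) ^+ 2
    <= trace_pow p (Y t) - trace_pow p (Y r).
Proof.
have [K K0 hK] := Y_taylor.
have kf0 : 0 <= kf by exact: powR_ge0.
exists (m%:R * (kf * K)) => [|r t Q x r0 rt t1 dQ]; first by rewrite !mulr_ge0.
have t_ge0 := le_trans r0 rt; have r1 := le_trans rt t1.
have [P [y dP]] := spectral_theorem _ _ _ (info_mx_sym _ _ _ _ hM (fun i => U r i `^ q)).
have pn0 : p != 0 by rewrite gt_eqF.
have p01 : 0 <= p <= 1 by rewrite !ltW.
have xt a := Y_eigenvalue_ge _ _ _ a t_ge0 dQ.
have := trace_power_tangent _ _ _ _ _ _ _ _ _ p01 dQ dP
  (fun a => lt_le_trans t0_gt0 (xt a))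
  (fun b => le_trans (ltW t0_gt0) (Y_eigenvalue_ge _ _ _ b r0 dP)).
rewrite (spectral_dec_trace_pow _ _ _ _ _ _ dQ pn0) (spectral_dec_trace_pow _ _ _ _ _ _ dP pn0).
set E := Y r - Y t - (q * (r - t)) *: N t.
have -> : Y r - Y t = (q * (r - t)) *: N t + E by rewrite /E [RHS]addrC subrK.
rewrite spectral_traceD spectral_traceZ mulrDr.
have := spectral_trace_bound _ _ _ _ _ E _ (proj1 dQ) (fun a => f_bound _ (xt a)).
have := ler_wpM2l kf0 (hK _ _ t_ge0 t1 r0 r1).
move=> /(ler_wpM2l (ler0n R m)) hE hE' => hKl.
have {}hE := le_trans hE' hE; rewrite ler_norml in hE; case/andP: hE => _ hE.
have pE : p * spectral_trace R m f Q x E <= m%:R * (kf * (K * (r - t) ^+ 2)).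
  apply: (le_trans (ler_wpM2l (ltW p0) hE)); rewrite ler_piMl ?(ltW p1)//.
  by apply: mulr_ge0 => //; apply: mulr_ge0 => //; apply: mulr_ge0 => //; exact: sqr_ge0.
have e : p * (q * (r - t) * spectral_trace R m f Q x (N t)) = - ((t - r) * spectral_trace R m f Q x (N t)).
  have pq : p * q = 1 by rewrite divff.
  by rewrite !mulrA pq; ring.
have e2 : m%:R * (kf * K) * (t - r) ^+ 2 = m%:R * (kf * (K * (r - t) ^+ 2)) by ring.
rewrite e2; move: hKl; rewrite e; lra.
Qed.

(** The increment splits into a change of spectrum with [N r] fixed, given by the exact double sum,
    and a change from [N r] to [N t] in the basis [Q]. The first-order parts combine to a
    nonnegative quantity by [gradient_form_ge0]; the rest is quadratic. *)
Let gradient_step : exists2 K, 0 <= K & forall r t Q x P y, 0 <= r -> r <= t -> t <= 1 ->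
  spectral_dec (Y t) Q x -> spectral_dec (Y r) P y ->
  - (K * (t - r) ^+ 2)
    <= spectral_trace R m f Q x (N t) - spectral_trace R m f P y (N r).
Proof.
have [KY KY0 hKY] := Y_lip; have [KT KT0 hKT] := Y_taylor.
have [KN KN0 hKN] := N_taylor; have [KB KB0 hKB] := NL_bound.
have kf0 : 0 <= kf by exact: powR_ge0.
have kd0 : 0 <= kd by rewrite mulr_ge0 ?powR_ge0.
have q10 : 0 <= (q - 1) / 2 by rewrite divr_ge0// subr_ge0 ltW.
exists (m%:R ^+ 2 * (kd * KT * KB) + m%:R * (kf * KN)
    + (q - 1) / 2 * (m%:R ^+ 2 * (kd * KY * KB))) => [|r t Q x P y r0 rt t1 dQ dP].
  have m2 : 0 <= m%:R ^+ 2 :> R by exact: exprn_ge0.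
  have kk a b : 0 <= a -> 0 <= b -> 0 <= kd * a * b by move=> ha hb; exact: mulr_ge0 (mulr_ge0 kd0 ha) hb.
  apply: addr_ge0; first apply: addr_ge0.
  - by apply: mulr_ge0 => //; exact: kk.
  - exact: mulr_ge0 (ler0n _ _) (mulr_ge0 kf0 KN0).
  - by apply: mulr_ge0 => //; apply: mulr_ge0 => //; exact: kk.
have t_ge0 := le_trans r0 rt; have r1 := le_trans rt t1.
have d0 : 0 <= t - r by rewrite subr_ge0.
have [hN hL] := hKB r r0 r1.
have xt a := Y_eigenvalue_ge _ _ _ a t_ge0 dQ.
have yt b := Y_eigenvalue_ge _ _ _ b r0 dP.
have QQ := proj1 dQ; have PP := proj1 dP.
pose g a b := divided_difference R f (x 0 a) (y 0 b).
have gk a b : `|g a b| <= kd by exact: kd_bound.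
have symN : (N r)^T = N r by exact: info_mx_sym.
have symL : (L r)^T = L r by exact: info_mx_sym.
pose S A := \sum_a \sum_b g a b * (Q *m A *m P^T) a b * (Q *m N r *m P^T) a b.
set E1 := Y t - Y r - (q * (t - r)) *: N r.
set E2 := N t - N r - ((q - 1) * (t - r)) *: L r.
have SE : S (Y t - Y r) = q * (t - r) * S (N r) + S E1.
  rewrite /S mulr_sumr -big_split; apply: eq_bigr => a _.
  rewrite mulr_sumr -big_split; apply: eq_bigr => b _ /=.
  have -> : (Q *m E1 *m P^T) a b = (Q *m (Y t - Y r) *m P^T) a b
       - q * (t - r) * (Q *m N r *m P^T) a b.
    rewrite /E1 mulmxBr mulmxBl -scalemxAr -scalemxAl [LHS]mxE; congr (_ + _).
    by rewrite mxE; congr (- _); rewrite mxE.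
  by ring.
have e1 : spectral_trace R m f Q x (N r) - spectral_trace R m f P y (N r)
    = q * (t - r) * S (N r) + S E1.
  by rewrite (spectral_trace_diff _ _ _ _ _ _ _ _ _ _ dQ dP symN) -SE.
have e2 : spectral_trace R m f Q x (N t) = spectral_trace R m f Q x (N r)
    + (q - 1) * (t - r) * spectral_trace R m f Q x (L r) + spectral_trace R m f Q x E2.
  by rewrite -spectral_traceZ -!spectral_traceD /E2; congr spectral_trace; rewrite -(addrA (N t)) -opprD [RHS]addrC subrK.
have main := gradient_form_ge0 _ _ _ _ _ _ r0 rt dQ dP.
have main' := mulr_ge0 d0 main.
have b1 : `|S E1| <= m%:R ^+ 2 * (kd * KT * KB) * (t - r) ^+ 2.
  apply: le_trans (double_sum_bound _ _ _ _ _ _ _ kd QQ PP gk) _.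
  have := ler_pM (entry_norm_ge0 _ _ E1) (entry_norm_ge0 _ _ (N r)) (hKT _ _ r0 r1 t_ge0 t1) hN.
  move=> /(ler_wpM2l kd0) /(ler_wpM2l (exprn_ge0 2 (ler0n R m))).
  lra.
have b2 : `|spectral_trace R m f Q x E2| <= m%:R * (kf * KN) * (t - r) ^+ 2.
  apply: le_trans (spectral_trace_bound _ _ _ _ _ E2 _ QQ (fun a => f_bound _ (xt a))) _.
  by rewrite -!mulrA ler_wpM2l// ler_wpM2l// hKN.
(* [gradient_form_ge0] averages the traces of [L r] over both endpoints, while the expansion has the
   one at [t]. Their difference is of order t - r and enters with another factor t - r. *)
have b3 : `|spectral_trace R m f Q x (L r) - spectral_trace R m f P y (L r)|
    <= m%:R ^+ 2 * (kd * KY * KB) * (t - r).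
  apply: le_trans (spectral_trace_lipschitz _ _ _ _ _ _ _ _ _ _ kd dQ dP symL gk) _.
  have := ler_pM (entry_norm_ge0 _ _ (Y t - Y r)) (entry_norm_ge0 _ _ (L r)) (hKY _ _ r0 rt t1) hL.
  move=> /(ler_wpM2l kd0) /(ler_wpM2l (exprn_ge0 2 (ler0n R m))).
  lra.
have b3' := ler_wpM2l d0 (ler_wpM2l q10 b3).
move: b1 b2; rewrite !ler_norml => /andP[b1 _] /andP[b2 _].
have b4 : - ((t - r) * ((q - 1) / 2 * (m%:R ^+ 2 * (kd * KY * KB) * (t - r))))
   <= (t - r) * ((q - 1) / 2 * (spectral_trace R m f Q x (L r) - spectral_trace R m f P y (L r))).
  rewrite -mulrN -mulrN ler_wpM2l// ler_wpM2l//.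
  by move: b3; rewrite ler_norml => /andP[].
rewrite e2; move: main' e1 b1 b2 b4; rewrite -/(S (N r)).
set TL := spectral_trace R m f Q x (L r); set SL := spectral_trace R m f P y (L r).
set TN := spectral_trace R m f Q x (N r); set SN := spectral_trace R m f P y (N r).
set c1 := m%:R ^+ 2 * _; set c2 := m%:R * _; set c3 := m%:R ^+ 2 * _.
lra.
Qed.

Lemma trace_power_path_tangent Q x : spectral_dec (Y 0) Q x ->
  spectral_trace R m f Q x (N 0) <= trace_pow p (Y 1) - trace_pow p (Y 0).
Proof.
move=> dQ.
have hex t : exists d : 'M[R]_m * 'rV[R]_m, spectral_dec (Y t) d.1 d.2.
  have [P [y dP]] := spectral_theorem _ _ _ (info_mx_sym _ _ _ _ hM (fun i => U t i `^ q)).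
  by exists (P, y).
(* The eigenbases along the path are chosen without any continuity; the constants of both step
   estimates are uniform in them. *)
have [D hD] := choice hex.
have [K K0 hK] := value_step; have [K' K'0 hK'] := gradient_step.
pose theta t := spectral_trace R m f (D t).1 (D t).2 (N t).
have -> : spectral_trace R m f Q x (N 0) = theta 0.
  by apply: spectral_trace_unique (dQ) (hD 0) _; exact: info_mx_sym.
apply: (le_of_small_steps _ (fun t => trace_pow p (Y t)) theta (K + K')); first exact: addr_ge0.
  move=> r t r0 rt t1; apply: le_trans (hK _ _ _ _ r0 rt t1 (hD t)).
  by rewrite lerD2l lerN2 ler_wpM2r ?sqr_ge0// lerDl.
move=> r t r0 rt t1; apply: le_trans (hK' _ _ _ _ _ _ r0 rt t1 (hD t) (hD r)).
by rewrite lerN2 ler_wpM2r ?sqr_ge0// lerDr.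
Qed.

End ConvexPath.

(** * Definite matrices and the trace of a power *)

Section PosDef.
Variables (R : realType).

Lemma positive_lower_bound (I : finType) (u : I -> R) : (forall i, 0 < u i) ->
  exists2 lo, 0 < lo & forall i, lo <= u i.
Proof.
move=> u0; exists (1 + \sum_i (u i)^-1)^-1 => [|i].
  by rewrite invr_gt0 ltr_wpDr// sumr_ge0// => i _; rewrite invr_ge0 ltW.
rewrite -[leRHS]invrK lef_pV2 ?posrE ?invr_gt0//; last first.
  by rewrite ltr_wpDr// sumr_ge0// => j _; rewrite invr_ge0 ltW.
rewrite (bigD1 i)//= addrCA lerDl addr_ge0// sumr_ge0// => j _.
by rewrite invr_ge0 ltW.
Qed.

Lemma le_of_small_error (a b C e0 : R) : 0 < e0 -> 0 <= C ->
  (forall e, 0 < e -> e <= e0 -> a <= b + C * e) -> a <= b.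
Proof.
move=> e00 C0 h; apply/ler_addgt0Pr => d d0.
pose e := Num.min e0 (d / (C + 1)).
have C1 : 0 < C + 1 by rewrite ltr_wpDl.
have ep : 0 < e by rewrite lt_min e00 divr_gt0.
have ele : e <= e0 by rewrite ge_min lexx.
apply: le_trans (h e ep ele) _; rewrite lerD2l.
apply: (@le_trans _ _ ((C + 1) * e)); first by rewrite ler_pM2r// lerDl.
by rewrite mulrC -ler_pdivlMr// ge_min lexx orbT.
Qed.

Variable m : nat.
Implicit Types (A B N P Q X : 'M[R]_m) (d x : 'rV[R]_m) (v : 'cV[R]_m) (p t k : R).

(** Positive definiteness with an explicit spectral margin, which passes directly to larger forms
    and bounds eigenvalues from below. *)
Definition definite A := exists2 t, 0 < t & forall v, t * qform 1%:M v v <= qform A v v.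

Lemma definiteP A Q d : spectral_dec A Q d -> (forall a, 0 < d 0 a) -> definite A.
Proof.
move=> dA /positive_lower_bound[t t0 ht]; exists t => // v.
exact: (spectral_dec_form_ge _ _ _ _ _ _ _ dA).
Qed.

Lemma definite_eigenvalue_gt0 A Q d a : definite A -> spectral_dec A Q d -> 0 < d 0 a.
Proof. by move=> [t t0 ht] dA; apply: lt_le_trans t0 (spectral_dec_ge _ _ _ _ _ _ _ dA ht). Qed.

Lemma definite_le A B : definite A -> (forall v, qform A v v <= qform B v v) -> definite B.
Proof. by move=> [t t0 ht] hAB; exists t => // v; exact: le_trans (ht v) (hAB v). Qed.

Lemma definiteZ A k : 0 < k -> definite A -> definite (k *: A).
Proof.
move=> k0 [t t0 ht]; exists (k * t) => [|v]; first exact: mulr_gt0.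
by rewrite qformZl -mulrA ler_pM2l.
Qed.

Lemma form1_ge0 v : 0 <= qform 1%:M v v.
Proof.
by rewrite /qform mulmx1 mxE; apply: sumr_ge0 => i _; rewrite mxE -expr2 sqr_ge0.
Qed.

Lemma definite_psd A : A^T = A -> definite A -> psdmx A.
Proof.
move=> sA [t t0 ht]; apply: psdmxP => // v.
by apply: le_trans (ht v); rewrite mulr_ge0 ?form1_ge0 ?(ltW t0).
Qed.

Lemma spectral_dec_psd A : psdmx A -> exists Q d, spectral_dec A Q d /\ forall a, 0 <= d 0 a.
Proof.
move=> pA; have [Q [d dA]] := spectral_theorem _ _ _ (psdmx_sym _ _ _ pA).
by exists Q, d; split=> // a; exact: psdmx_eigenvalue_ge0 dA.
Qed.

Lemma full_rank_definite A : psdmx A -> \rank A = m -> definite A.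
Proof.
move=> pA rA; have [Q [d [dA d0]]] := spectral_dec_psd _ pA.
apply: (definiteP _ _ _ dA) => a; rewrite lt_neqAle d0 andbT eq_sym.
apply/negP => /eqP da0; move: rA; rewrite (spectral_dec_rank _ _ _ _ _ dA).
move/eqP; apply/negP; rewrite neq_ltn; apply/orP; left.
rewrite -[X in (_ < X)%N]card_ord -sum1_card (bigD1 a)//= [ltnRHS](bigD1 a)//= da0 eqxx.
by rewrite add0n add1n ltnS; apply: leq_sum => i _; exact: leq_b1.
Qed.

Lemma definite_rank A : psdmx A -> definite A -> \rank A = m.
Proof.
move=> pA hA; have [Q [d [dA _]]] := spectral_dec_psd _ pA.
rewrite (spectral_dec_rank _ _ _ _ _ dA) -[RHS]card_ord -sum1_card.
by apply: eq_bigr => a _; rewrite gt_eqF// (definite_eigenvalue_gt0 _ _ _ a hA dA).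
Qed.

Lemma psdmx_bounded A : psdmx A ->
  exists2 t, 0 < t & forall v, qform A v v <= t * qform 1%:M v v.
Proof.
move=> pA; have [Q [d [dA d0]]] := spectral_dec_psd _ pA.
have [QQ eA] := dA.
(* The sum of the nonnegative eigenvalues dominates each of them; the 1 makes the bound strictly
   positive. *)
exists (1 + \sum_a d 0 a) => [|v]; first by rewrite ltr_wpDr// sumr_ge0.
rewrite -subr_ge0.
have dI : spectral_dec (((1 + \sum_a d 0 a)%:M) - A) Q (\row_a (1 + \sum_a d 0 a - d 0 a)).
  split=> //; rewrite [X in _ - X]eA.
  have -> : diag_mx (\row_a (1 + \sum_a d 0 a - d 0 a)) = (1 + \sum_a d 0 a)%:M - diag_mx d.
    by apply/matrixP => i j; rewrite !mxE mulrnBl.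
  by rewrite mulmxBr mulmxBl mul_mx_scalar -scalemxAl (mulmx1C QQ) scalemx1.
have -> : (1 + \sum_a d 0 a) * qform 1%:M v v - qform A v v
   = qform ((1 + \sum_a d 0 a)%:M - A) v v.
  by rewrite -[(_ + _)%:M]scalemx1 -[in RHS](scaleN1r A) qformDl !qformZl mulN1r.
rewrite (spectral_dec_form _ _ _ _ _ _ dI); apply: sumr_ge0 => a _.
rewrite mulr_ge0 ?sqr_ge0// mxE subr_ge0 (bigD1 a)//= addrCA lerDl addr_ge0//.
exact: sumr_ge0.
Qed.

Lemma spectral_decZ A Q d k : spectral_dec A Q d -> spectral_dec (k *: A) Q (k *: d).
Proof.
move=> [QQ ->]; split=> //; rewrite scalemxAl; congr (_ *m _); rewrite scalemxAr.
congr (_ *m _); apply/matrixP => i j; rewrite !mxE; exact: mulrnAr.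
Qed.

Lemma spectral_dec_shift A Q d t : spectral_dec A Q d -> spectral_dec (A + t%:M) Q (\row_a (d 0 a + t)).
Proof.
move=> [QQ ->]; split=> //.
have -> : diag_mx (\row_a (d 0 a + t)) = diag_mx d + t%:M.
  by apply/matrixP => i j; rewrite !mxE mulrnDl.
by rewrite mulmxDr mulmxDl mul_mx_scalar -scalemxAl (mulmx1C QQ) scalemx1.
Qed.

Lemma trace_powZ p A k : psdmx A -> p != 0 -> 0 <= k -> trace_pow p (k *: A) = k `^ p * trace_pow p A.
Proof.
move=> pA p0 k0; have [Q [d [dA d0]]] := spectral_dec_psd _ pA.
rewrite (spectral_dec_trace_pow _ _ _ _ _ _ (spectral_decZ _ _ _ k dA) p0).
rewrite (spectral_dec_trace_pow _ _ _ _ _ _ dA p0) mulr_sumr.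
by apply: eq_bigr => a _; rewrite mxE powRM.
Qed.

Lemma trace_pow_ge0 p A : 0 <= trace_pow p A.
Proof. by rewrite /trace_pow; case: ifP => // _; apply: sumr_ge0 => *; exact: powR_ge0. Qed.

Lemma spectral_trace_ge0 (f : R -> R) Q x N : (forall z, 0 <= f z) -> psdmx N ->
  0 <= spectral_trace R m f Q x N.
Proof.
move=> f0 pN; apply: sumr_ge0 => a _; rewrite mulr_ge0// -qform_row.
exact: psdmx_form.
Qed.

(** Klein's inequality is applied with tangent point [B], so that [A] may be singular; its linear
    term, the trace of B^(p-1) (A - B), is nonpositive. *)
Lemma trace_pow_le p A B : 0 < p -> p <= 1 -> psdmx A -> B^T = B -> definite B ->
  (forall v, qform A v v <= qform B v v) -> trace_pow p A <= trace_pow p B.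
Proof.
move=> p0 p1 pA sB dB hAB.
have [P [a [dA a0]]] := spectral_dec_psd _ pA.
have [Q [b [dQ b0]]] := spectral_dec_psd _ (definite_psd _ sB dB).
have pn0 : p != 0 by rewrite gt_eqF.
rewrite (spectral_dec_trace_pow _ _ _ _ _ _ dA pn0) (spectral_dec_trace_pow _ _ _ _ _ _ dQ pn0).
have p01 : 0 <= p <= 1 by rewrite ltW.
apply: le_trans (trace_power_tangent _ _ _ _ _ _ _ _ _ p01 dQ dA _ a0) _.
  by move=> i; exact: definite_eigenvalue_gt0 dB dQ.
rewrite -[leRHS]addr0 lerD2l mulr_ge0_le0 ?(ltW p0)//.
rewrite spectral_traceB -opprB oppr_le0 -spectral_traceB.
apply: spectral_trace_ge0 => [z|]; first exact: powR_ge0.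
apply: psdmxP => [|v]; first by rewrite linearB /= sB psdmx_sym.
by rewrite -(scaleN1r A) qformDl qformZl mulN1r subr_ge0.
Qed.

Lemma trace_pow_shift p A t : 0 < p -> p <= 1 -> psdmx A -> 0 <= t ->
  trace_pow p (A + t%:M) <= trace_pow p A + m%:R * t `^ p.
Proof.
move=> p0 p1 pA t0; have [P [a [dA a0]]] := spectral_dec_psd _ pA.
have pn0 : p != 0 by rewrite gt_eqF.
rewrite (spectral_dec_trace_pow _ _ _ _ _ _ dA pn0).
rewrite (spectral_dec_trace_pow _ _ _ _ _ _ (spectral_dec_shift _ _ _ t dA) pn0).
rewrite mulr_natl -[m in _ *+ m]card_ord -sumr_const -big_split.
by apply: ler_sum => i _; rewrite mxE powR_subadd.
Qed.

End PosDef.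

(** * The tangent inequality for weighted traces, 0 < p < 1 *)

Lemma spectral_trace0 (R : realType) (m : nat) f Q x : spectral_trace R m f Q x 0 = 0.
Proof. by rewrite -(subrr 0) spectral_traceB subrr. Qed.

Section WeightedTrace.
Variables (R : realType) (s m : nat) (M : 'I_s -> 'M[R]_m).
Hypothesis hM : forall i, psdmx (M i).
Implicit Types (p : R) (w : 'I_s -> R) (S : {set 'I_s}).

Lemma sum_set_info_mx S : \sum_(i in S) M i = info_mx M (fun i => (i \in S)%:R).
Proof.
rewrite /info_mx big_mkcond; apply: eq_bigr => i _.
by case: (i \in S); rewrite ?scale1r ?scale0r.
Qed.

Lemma sum_set_psd S : psdmx (\sum_(i in S) M i).
Proof. by rewrite sum_set_info_mx; apply: info_mx_psd => // i; rewrite ler0n. Qed.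

(** The path starts at u = w^p, where the matrix is [X], and ends at [v], equal to c on [S] and c e
    off [S]. Dividing by c leaves an error of order e, which is sent to 0. *)
Lemma weighted_trace_le p w S Q x : 0 < p -> p < 1 -> (forall i, 0 <= w i) ->
  definite R m (info_mx M w) -> spectral_dec (info_mx M w) Q x ->
  \sum_(i in S) powRz (w i) (1 - p) * spectral_trace R m (fun z => z `^ (p - 1)) Q x (M i)
    <= trace_pow p (\sum_(i in S) M i).
Proof.
move=> p0 p1 w0 dX dQ; set X := info_mx M w in dX dQ *.
pose f z : R := z `^ (p - 1).
have pn0 : p != 0 by rewrite gt_eqF.
have pq : p * p^-1 = 1 by rewrite divff.
have f0 z : 0 <= f z by exact: powR_ge0.
have [t t0 ht] := psdmx_bounded _ _ _ (info_mx_psd _ _ _ _ hM (fun=> 1) (fun=> ler01)).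
apply: (@le_of_small_error _ _ _ (m%:R * t `^ p) 1); rewrite ?mulr_ge0 ?powR_ge0//.
move=> e e0 e1.
(* Indices of weight 0 get the zero matrix and u_i = 1: [X] is unchanged, while the path starts at a
   strictly positive point, as the powers along it require. *)
pose M' i := if w i == 0 then 0 else M i.
pose u i := if w i == 0 then 1 else w i `^ p.
have u0 i : 0 < u i.
  by rewrite /u; case: ifPn => // wn0; rewrite powR_gt0// lt_neqAle eq_sym wn0 w0.
have hM' i : psdmx (M' i).
  rewrite /M'; case: ifP => // _; apply: psdmxP => [|v]; first exact: trmx0.
  by rewrite qform0l.
(* This makes c e exceed every u_i, so that v >= u even off [S]. A large c is harmless by
   homogeneity. *)
pose c := (\sum_i u i + 1) / e.
have c1 : 0 < \sum_i u i + 1 by rewrite ltr_wpDl// sumr_ge0// => i _; exact: ltW.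
have c0 : 0 < c by exact: divr_gt0.
pose v i := c * (if i \in S then 1 else e).
have uv i : u i <= v i.
  apply: (@le_trans _ _ (c * e)); last first.
    by rewrite /v ler_pM2l//; case: ifP.
  rewrite /c divfK ?gt_eqF// (bigD1 i)//= -addrA lerDl addr_ge0// sumr_ge0// => j _.
  exact: ltW.
have [lo lo0 hlo] := positive_lower_bound _ _ _ u0.
have XE : info_mx M' (fun i => (u i + 0 * (v i - u i)) `^ p^-1) = X.
  apply: eq_bigr => i _; rewrite mul0r addr0 /u /M'; case: ifPn => [/eqP->|_].
    by rewrite scaler0 scale0r.
  by rewrite -powRrM pq powRr1.
have h0 i : 0 <= v i - u i by rewrite subr_ge0.
have [t1 t10 ht1] := dX; rewrite -XE in ht1.
have := trace_power_path_tangent _ _ _ _ hM' p p0 p1 u (fun i => v i - u i) lo t1 lo0 hlo h0 t10 ht1 Q x.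
rewrite XE => /(_ dQ).
pose Y1 := info_mx M' (fun i => v i `^ p^-1).
have -> : info_mx M' (fun i => (u i + 1 * (v i - u i)) `^ p^-1) = Y1.
  by apply: eq_info_mx => i; rewrite mul1r subrKC.
(* The direction v - u splits off [X] itself. The trace of X^(p-1) X is that of X^p, so this part
   cancels the initial value of the trace power. *)
have -> : info_mx M' (fun i => (u i + 0 * (v i - u i)) `^ (p^-1 - 1) * (v i - u i))
  = info_mx M' (fun i => u i `^ (p^-1 - 1) * v i) - X.
  rewrite -XE info_mxB; apply: eq_info_mx => i; rewrite mul0r addr0 mulrBr; congr (_ - _).
  by rewrite mulrC mulr_powRB1 ?ltW// invr_gt0.
rewrite spectral_traceB (spectral_trace_self _ _ _ _ _ _ dQ).
rewrite (spectral_dec_trace_pow _ _ _ _ _ _ dQ pn0).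
have x0 a := definite_eigenvalue_gt0 _ _ _ _ _ a dX dQ.
have -> : \sum_a x 0 a `^ (p - 1) * x 0 a = \sum_a x 0 a `^ p.
  by apply: eq_bigr => a _; rewrite mulrC mulr_powRB1// ltW.
rewrite lerD2r => hpath.
pose A := \sum_(i in S) M i.
pose k := c `^ p^-1.
have k0 : 0 < k by exact: powR_gt0.
have kp : k `^ p = c by rewrite -powRrM mulVf// powRr1 ?(ltW c0).
have pA : psdmx A by exact: sum_set_psd.
(* The end matrix is at most k (M_S + e^(1/p) t I), where t I dominates the sum of all [M i]. The
   p-th power turns k into c and the shift into an error m t^p e. *)
pose eq := e `^ p^-1.
have eqp : eq `^ p = e by rewrite -powRrM mulVf// powRr1 ?(ltW e0).
have eq0 : 0 < eq by exact: powR_gt0.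
pose Z := A + (eq * t)%:M.
have hYZ y : qform Y1 y y <= qform (k *: Z) y y.
  rewrite qformZl qformDl -[(eq * t)%:M]scalemx1 qformZl /Y1 info_mx_form /A sum_set_info_mx info_mx_form.
  have := ht y; rewrite info_mx_form => /(ler_wpM2l (ltW eq0)); rewrite mulrA.
  rewrite -(lerD2l (\sum_i (i \in S)%:R * qform (M i) y y)) => /(ler_wpM2l (ltW k0)).
  apply: le_trans; rewrite mulr_sumr -big_split mulr_sumr; apply: ler_sum => i _ /=.
  have Mi := psdmx_form _ _ _ y (hM i).
  have Mi' : qform (M' i) y y <= qform (M i) y y.
    by rewrite /M'; case: ifP => // _; rewrite qform0l.
  apply: le_trans (ler_wpM2l (powR_ge0 _ _) Mi') _.
  have ce : 0 <= e by exact: ltW.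
  rewrite /v powRM ?(ltW c0)//; last by case: ifP.
  rewrite -/k -mulrA ler_pM2l//; case: ifP => _.
    by rewrite powR1 !mul1r lerDl mulr_ge0// ltW.
  by rewrite mul0r add0r mul1r.
have pY : psdmx Y1 by apply: info_mx_psd => // i; exact: powR_ge0.
have dY : definite R m Y1.
  apply: definite_le dX _ => y; rewrite -XE; apply: info_mx_le => // i.
  by rewrite mul0r addr0 powR_ndecr ?invr_ge0 ?(ltW p0) ?(ltW (u0 i)).
have sZ : (k *: Z)^T = k *: Z.
  by rewrite linearZ /= linearD /= tr_scalar_mx psdmx_sym.
have dZ : definite R m (k *: Z) by exact: definite_le dY hYZ.
have p1' := ltW p1.
have hY := trace_pow_le _ _ _ _ _ p0 p1' pY sZ dZ hYZ.
have pZ : psdmx Z.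
  apply: psdmxP => [|y]; first by rewrite linearD /= tr_scalar_mx psdmx_sym.
  rewrite qformDl -[(eq * t)%:M]scalemx1 qformZl addr_ge0 ?psdmx_form//.
  by rewrite !mulr_ge0 ?form1_ge0// ltW.
rewrite (trace_powZ _ _ _ _ _ pZ pn0 (ltW k0)) kp in hY.
have hZ : trace_pow p Z <= trace_pow p A + m%:R * (eq * t) `^ p.
  by apply: trace_pow_shift => //; rewrite mulr_ge0// ltW.
rewrite powRM ?(ltW eq0) ?(ltW t0)// eqp in hZ.
rewrite -/A -mulrA (mulrC _ e); apply: le_trans _ hZ.
rewrite -(ler_pM2l c0); apply: le_trans _ hY; apply: le_trans _ hpath.
rewrite /info_mx (spectral_trace_sum _ _ _ _ _ _ predT).
(* Terms outside [S] are nonnegative and are dropped; inside, u_i^(1/p - 1) = w_i^(1-p). *)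
rewrite [leRHS](bigID (mem S))/= mulr_sumr -[leLHS]addr0 lerD//; last first.
  apply: sumr_ge0 => i _; rewrite spectral_traceZ mulr_ge0 ?spectral_trace_ge0//.
  by rewrite mulr_ge0 ?powR_ge0// ltW// (lt_le_trans (u0 i)).
apply: ler_sum => i iS; rewrite spectral_traceZ /u /v iS mulr1 /M' /powRz.
case: ifPn => [_|wn0]; first by rewrite mul0r mulr0 spectral_trace0 mulr0.
rewrite -powRrM mulrBr pq mulr1 -/f.
by rewrite le_eqVlt; apply/orP; left; apply/eqP; ring.
Qed.

End WeightedTrace.

(** * Rank inequalities for p = 0 *)

Section RankCase.
Variables (R : realType) (m : nat).
Implicit Types (A B X Q P : 'M[R]_m).

Lemma psdmx_isotropic A v : psdmx A -> qform A v v = 0 -> A *m v = 0.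
Proof.
move=> pA; have [Q [d [dA d0]]] := spectral_dec_psd _ _ _ pA.
rewrite (spectral_dec_form _ _ _ _ _ _ dA) => /psumr_eq0P h.
have [_ ->] := dA; rewrite -mulmxA -mulmxA; suff -> : diag_mx d *m (Q *m v) = 0 by rewrite mulmx0.
apply/matrixP => a j; rewrite !ord1 mul_diag_mx [LHS]mxE [RHS]mxE; apply/eqP.
have /eqP : d 0 a * ((Q *m v) a 0) ^+ 2 = 0.
  by apply: h => // i _; rewrite mulr_ge0 ?sqr_ge0.
by rewrite mulf_eq0 sqrf_eq0 mulf_eq0.
Qed.

(** A vector in the kernel of [B] is isotropic for [A], hence in the kernel of [A]; the kernels are
    nested, and the ranks compare the other way. *)
Lemma psdmx_rank_le A B (k : R) : psdmx A -> psdmx B ->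
  (forall v, qform A v v <= k * qform B v v) -> (\rank A <= \rank B)%N.
Proof.
move=> pA pB hAB.
have : (kermx B <= kermx A)%MS.
  apply/row_subP => i; rewrite sub_kermx; set v := row i (kermx B).
  have vB : v *m B = 0 by apply/sub_kermxP; exact: row_sub.
  have : A *m v^T = 0.
    apply: psdmx_isotropic => //; apply/eqP; rewrite eq_le psdmx_form// andbT.
    by apply: le_trans (hAB _) _; rewrite /qform trmxK vB mul0mx mxE mulr0.
  by move/(congr1 trmx); rewrite trmx_mul trmxK psdmx_sym// trmx0 => ->.
move/mxrankS; rewrite !mxrank_ker => h.
by have := rank_leq_row A; have := rank_leq_row B; lia.
Qed.

(** In an eigenbasis p_k of [B] the trace of X^-1 B is the sum of b_k p_k^T X^-1 p_k. Each term with
    b_k > 0 is at most 1, and the rank counts these terms. *)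
Lemma spectral_trace_inv_le_rank X B Q x : definite R m X -> spectral_dec X Q x ->
  psdmx B -> (forall v, qform B v v <= qform X v v) ->
  spectral_trace R m (fun z => z^-1) Q x B <= (\rank B)%:R.
Proof.
move=> dX dQ pB hBX; have [P [b [dB b0]]] := spectral_dec_psd _ _ _ pB.
have x0 a := definite_eigenvalue_gt0 _ _ _ _ _ a dX dQ.
have [QQ _] := dQ; have [PP _] := dB.
rewrite (spectral_trace_orth _ _ _ _ _ _ _ PP) (spectral_dec_rank _ _ _ _ _ dB) natr_sum.
pose O := Q *m P^T; rewrite -/O exchange_big; apply: ler_sum => k _.
pose g := \sum_a O a k ^+ 2 / x 0 a.
have -> : \sum_a (x 0 a)^-1 * (Q *m B *m P^T) a k * O a k = b 0 k * g.
  rewrite mulr_sumr; apply: eq_bigr => a _.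
  by rewrite (mixed_right _ _ _ _ _ _ _ _ dB) -/O; ring.
have [->|bk] := eqVneq (b 0 k) 0; first by rewrite mul0r ler0n.
have bk0 : 0 < b 0 k by rewrite lt_neqAle eq_sym bk b0.
(* The test vector is X^-1 p_k. With g = p_k^T X^-1 p_k, comparing the two forms there gives b_k g^2
   <= g. *)
pose cf : 'cV[R]_m := \col_a (O a k / x 0 a).
have := hBX (Q^T *m cf).
rewrite (spectral_dec_form _ _ _ _ _ _ dQ) mulmxA QQ mul1mx.
have -> : \sum_a x 0 a * cf a 0 ^+ 2 = g.
  by apply: eq_bigr => a _; rewrite mxE; field; rewrite gt_eqF.
rewrite (spectral_dec_form _ _ _ _ _ _ dB).
have Pk : (P *m (Q^T *m cf)) k 0 = g.
  have -> : P *m (Q^T *m cf) = O^T *m cf by rewrite /O trmx_mul trmxK mulmxA.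
  by rewrite mxE; apply: eq_bigr => a _; rewrite !mxE expr2 mulrA.
move=> hg; have hkg : b 0 k * g ^+ 2 <= g.
  apply: le_trans hg; rewrite (bigD1 k)//= Pk lerDl sumr_ge0// => i _.
  by rewrite mulr_ge0 ?sqr_ge0.
have : 0 <= g.
  by apply: sumr_ge0 => a _; rewrite divr_ge0 ?sqr_ge0// ltW.
rewrite le_eqVlt => /orP[/eqP <-|g0]; first by rewrite mulr0 ler01.
by rewrite -(ler_pM2r g0) mul1r -mulrA -expr2.
Qed.

End RankCase.

(** The left side is the trace of X^-1 B for the weights restricted to [S]. Here B <= X bounds it by
    the rank of [B], and [B] is dominated by the total weight times M_S. *)
Lemma weighted_rank_le (R : realType) (s m : nat) (M : 'I_s -> 'M[R]_m)
    (w : 'I_s -> R) (S : {set 'I_s}) Q x :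
  (forall i, psdmx (M i)) -> (forall i, 0 <= w i) ->
  definite R m (info_mx M w) -> spectral_dec (info_mx M w) Q x ->
  \sum_(i in S) w i * spectral_trace R m (fun z => z^-1) Q x (M i)
    <= (\rank (\sum_(i in S) M i)%R)%:R.
Proof.
move=> hM w0 dX dQ; pose B := info_mx M (fun i => (i \in S)%:R * w i).
have pB : psdmx B by apply: info_mx_psd => // i; rewrite mulr_ge0.
have -> : \sum_(i in S) w i * spectral_trace R m (fun z => z^-1) Q x (M i)
    = spectral_trace R m (fun z => z^-1) Q x B.
  rewrite /B /info_mx (spectral_trace_sum _ _ _ _ _ _ predT) big_mkcond; apply: eq_bigr => i _.
  by rewrite spectral_traceZ; case: (i \in S); rewrite ?mul1r ?mul0r.
apply: le_trans (spectral_trace_inv_le_rank _ _ _ _ _ _ dX dQ pB _) _.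
  move=> v; apply: info_mx_le => // i.
  by case: (i \in S); rewrite ?mul1r ?mul0r.
rewrite ler_nat; apply: (psdmx_rank_le _ _ _ _ (\sum_i w i) pB); first exact: sum_set_psd.
move=> v; rewrite sum_set_info_mx !info_mx_form mulr_sumr; apply: ler_sum => i _.
rewrite mulrA ler_wpM2r ?psdmx_form// mulrC ler_wpM2r ?ler0n//.
by rewrite (bigD1 i)//= lerDl sumr_ge0.
Qed.

(** * Determinants and the arithmetic-geometric mean *)

Section Determinant.
Variables (R : realType) (m : nat).
Implicit Types (A X Z Q P : 'M[R]_m).

Lemma psdmx_det_ge0 A : psdmx A -> 0 <= \det A.
Proof.
move=> pA; have [Q [d [dA d0]]] := spectral_dec_psd _ _ _ pA.
by rewrite (spectral_dec_det _ _ _ _ _ dA) prodr_ge0.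
Qed.

Lemma definite_det_gt0 A : psdmx A -> definite R m A -> 0 < \det A.
Proof.
move=> pA hA; have [Q [d [dA d0]]] := spectral_dec_psd _ _ _ pA.
rewrite (spectral_dec_det _ _ _ _ _ dA) prodr_gt0// => a _.
exact: definite_eigenvalue_gt0 hA dA.
Qed.

Lemma det_gt0_definite A : psdmx A -> 0 < \det A -> definite R m A.
Proof.
move=> pA hA; apply: full_rank_definite => //; apply: mxrank_unit.
by rewrite unitmxE unitfE gt_eqF.
Qed.

(* AM-GM for the eigenvalues of [Z^-1/2 X Z^-1/2]. *)
Lemma det_le_spectral_trace X Z Q z : psdmx X -> definite R m Z -> spectral_dec Z Q z ->
  \det X <= \det Z * (spectral_trace R m (fun y => y^-1) Q z X / m%:R) ^+ m.
Proof.
move=> pX dZ dQ.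
have z0 a := definite_eigenvalue_gt0 _ _ _ _ _ a dZ dQ.
pose r : 'rV[R]_m := \row_a (Num.sqrt (z 0 a))^-1.
pose C := diag_mx r *m (Q *m X *m Q^T) *m diag_mx r.
have pC : psdmx C.
  apply: psdmxP => [|v].
    by rewrite /C !trmx_mul !tr_diag_mx trmxK (psdmx_sym _ _ _ pX) !mulmxA.
  have := psdmx_form _ _ _ (Q^T *m (diag_mx r *m v)) pX; congr (0 <= _).
  by rewrite /qform /C !trmx_mul trmxK tr_diag_mx !mulmxA.
have [P [c [dC c0]]] := spectral_dec_psd _ _ _ pC.
have r2 a : r 0 a ^+ 2 = (z 0 a)^-1.
  by rewrite mxE exprVn sqr_sqrtr// ltW.
have trC : \sum_a c 0 a = spectral_trace R m (fun y => y^-1) Q z X.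
  transitivity (spectral_trace R m (fun=> 1) P c C).
    by rewrite (spectral_trace_self _ _ _ _ _ _ dC); apply: eq_bigr => a _; rewrite mul1r.
  transitivity (\tr C).
    transitivity (\tr (P *m C *m P^T)); first by apply: eq_bigr => a _; rewrite mul1r.
    by rewrite mxtrace_mulC mulmxA (mulmx1C (proj1 dC)) mul1mx.
  apply: eq_bigr => a _; rewrite /C mul_mx_diag mxE mul_diag_mx mxE -r2; ring.
have detC : \det X = \det Z * \det C.
  have QQ : \det Q * \det Q = 1 by rewrite -{2}(det_tr Q) -det_mulmx (proj1 dQ) det1.
  rewrite /C !det_mulmx det_tr !det_diag (spectral_dec_det _ _ _ _ _ dQ).
  have zr : (\prod_i z 0 i) * (\prod_i r 0 i * \prod_i r 0 i) = 1.
    rewrite -!big_split big1// => a _ /=.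
    by rewrite -expr2 r2 divff// gt_eqF.
  transitivity (\det X * (\det Q * \det Q) * ((\prod_i z 0 i) * (\prod_i r 0 i * \prod_i r 0 i))).
    by rewrite QQ zr !mulr1.
  ring.
have detZ : 0 <= \det Z.
  by rewrite (spectral_dec_det _ _ _ _ _ dQ) prodr_ge0// => a _; exact: ltW.
rewrite detC ler_wpM2l// (spectral_dec_det _ _ _ _ _ dC) -trC.
have [h _] := @leif_AGM R 'I_m predT (fun a => c 0 a) (fun a _ => c0 a).
by move: h; rewrite card_ord.
Qed.

End Determinant.

(** * Optimality *)

Section Criterion.
Variables (R : realType) (m : nat).
Hypothesis m0 : (0 < m)%N.
Implicit Types (A B : 'M[R]_m) (p r x y : R).

Lemma powR_le_inv r x y : 0 < r -> 0 <= x -> 0 <= y -> x `^ r <= y `^ r -> x <= y.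
Proof.
move=> r0 x0 y0 hxy; rewrite leNgt; apply/negP => yx.
have := gt0_ltr_powR r0 (_ : y \in Num.nneg) (_ : x \in Num.nneg) yx.
by rewrite !nnegrE => /(_ y0 x0); rewrite ltNge hxy.
Qed.

Lemma Phi_trace_pow_le p A B : 0 < p -> Phi p A <= Phi p B ->
  trace_pow p A <= trace_pow p B.
Proof.
move=> p0; rewrite /Phi gt_eqF// => h.
have mV : 0 < m%:R^-1 :> R by rewrite invr_gt0 ltr0n.
have pV : 0 < p^-1 by rewrite invr_gt0.
have tA c (C : 'M[R]_m) : 0 <= c -> 0 <= c * trace_pow p C by move=> c0; rewrite mulr_ge0// trace_pow_ge0.
have := powR_le_inv _ _ _ pV (tA _ A (ltW mV)) (tA _ B (ltW mV)) h.
by rewrite ler_pM2l.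
Qed.

Lemma Phi0_det_le A B : psdmx A -> psdmx B -> Phi 0 A <= Phi 0 B -> \det A <= \det B.
Proof.
move=> pA pB; rewrite /Phi eqxx => h.
have mV : 0 < m%:R^-1 :> R by rewrite invr_gt0 ltr0n.
exact: (powR_le_inv _ _ _ mV (psdmx_det_ge0 _ _ _ pA) (psdmx_det_ge0 _ _ _ pB) h).
Qed.

Lemma entry_normZ (c : R) A : entry_norm R m (c *: A) = `|c| * entry_norm R m A.
Proof.
rewrite /entry_norm mulr_sumr; apply: eq_bigr => k _.
by rewrite mulr_sumr; apply: eq_bigr => l _; rewrite mxE normrM.
Qed.

End Criterion.

Section Optimality.
Variables (R : realType) (m s n : nat) (M : 'I_s -> 'M[R]_m) (p : R) (w : 'I_s -> R).
Hypotheses (m0 : (0 < m)%N) (n0 : (1 <= n)%N) (hM : forall i, psdmx (M i)).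
Hypothesis hrank : \rank (\sum_i M i)%R = m.
Hypothesis hw : optimal p n M w.

Let X := info_mx M w.

Lemma optimal_ge0 i : 0 <= w i.
Proof. by case: hw => [[]]. Qed.

Let nR0 : 0 < n%:R :> R. Proof. by rewrite ltr0n. Qed.

Lemma optimal_psd : psdmx X.
Proof. by apply: info_mx_psd => // i; exact: optimal_ge0. Qed.

Lemma info_mx1_definite : definite R m (info_mx M (fun=> 1)).
Proof.
have e : info_mx M (fun=> 1) = \sum_i M i by apply: eq_bigr => i _; rewrite scale1r.
by apply: full_rank_definite; [apply: info_mx_psd|rewrite e hrank].
Qed.

Lemma optimal_le i : w i <= n%:R.
Proof.
case: hw => [[w0 hs] _]; apply: le_trans hs.
by rewrite (bigD1 i)//= lerDl sumr_ge0.
Qed.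

(** Mixing in nearly uniform weights adds a definite part to the matrix. The denominator s + 1 stays
    nonzero when s = 0 and keeps the budget. *)
Lemma feasible_mix (e : R) : 0 <= e -> e <= 1 ->
  feasible n (fun i => (1 - e) * w i + e * (n%:R / s.+1%:R)).
Proof.
move=> e0 e1; case: hw => [[w0 hs] _]; split=> [i|].
  by apply: addr_ge0; apply: mulr_ge0; rewrite ?divr_ge0 ?subr_ge0.
rewrite big_split /= -mulr_sumr sumr_const card_ord.
have h1 : (1 - e) * (\sum_i w i) <= (1 - e) * n%:R by rewrite ler_wpM2l ?subr_ge0.
have h2 : (e * (n%:R / s.+1%:R)) *+ s <= e * n%:R.
  rewrite -mulrnAr ler_wpM2l// -mulr_natr -mulrA ler_piMr//.
  by rewrite mulrC ler_pdivrMr ?ltr0n// mul1r ler_nat.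
by apply: le_trans (lerD h1 h2) _; rewrite -mulrDl subrK mul1r.
Qed.

(** For p = 0 the uniform weights already have positive determinant. For 0 < p < 1, if [X] were
    singular, moving a fraction e to uniform weights would gain order e^p and lose only order e. *)
Lemma optimal_definite : 0 <= p -> p < 1 -> definite R m X.
Proof.
move=> p0 p1; have hopt := proj2 hw.
have [t t0 ht] := info_mx1_definite.
pose c : R := n%:R / s.+1%:R.
have c0 : 0 < c by rewrite divr_gt0 ?ltr0n.
have mixE (e : R) : info_mx M (fun i => (1 - e) * w i + e * c)
    = (1 - e) *: X + (e * c) *: info_mx M (fun=> 1).
  rewrite /X !info_mxZ info_mxD; apply: eq_info_mx => i; by rewrite mulr1.
have mix_psd (e : R) : 0 <= e -> e <= 1 -> psdmx (info_mx M (fun i => (1 - e) * w i + e * c)).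
  by move=> e0 e1; apply: info_mx_psd => // i; case: (feasible_mix e e0 e1).
move: p0; rewrite le_eqVlt => /orP[/eqP p0|p0].
  have := hopt _ (feasible_mix 1 ler01 (lexx 1)); rewrite -p0 => /Phi0_det_le.
  move=> /(_ m0 (mix_psd 1 ler01 (lexx 1)) optimal_psd) hdet.
  apply: det_gt0_definite; first exact: optimal_psd.
  apply: lt_le_trans hdet; apply: definite_det_gt0; first exact: mix_psd.
  rewrite -/c mixE subrr scale0r add0r mul1r.
  by apply: definiteZ => //; exact: info_mx1_definite.
have [Q [x [dQ x0]]] := spectral_dec_psd _ _ _ optimal_psd.
apply: (definiteP _ _ _ _ _ dQ) => a; rewrite lt_neqAle x0 andbT eq_sym.
apply/negP => /eqP xa0.
have pn0 : p != 0 by rewrite gt_eqF.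
set T := trace_pow p X; pose K := (c * t) `^ p.
have K0 : 0 < K by rewrite powR_gt0// mulr_gt0.
have T0 : 0 <= T by exact: trace_pow_ge0.
have main (e : R) : 0 < e -> e <= 1 -> e `^ p * K <= e * T.
  move=> e0 e1.
  have := hopt _ (feasible_mix e (ltW e0) e1) => /(Phi_trace_pow_le _ _ m0 _ _ _ p0).
  rewrite -/c -/X -/T; set V := info_mx M _ => hV.
  have f0 : 0 <= 1 - e by rewrite subr_ge0.
  pose W := (1 - e) *: X + (e * (c * t))%:M.
  have dW := spectral_dec_shift _ _ _ _ _ (e * (c * t)) (spectral_decZ _ _ _ _ _ (1 - e) dQ).
  have ct0 : 0 < e * (c * t) by exact: mulr_gt0 e0 (mulr_gt0 c0 t0).
  have pW : psdmx W.
    apply: definite_psd; first by rewrite linearD linearZ /= tr_scalar_mx (psdmx_sym _ _ _ optimal_psd).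
    apply: (definiteP _ _ _ _ _ dW) => b; rewrite !mxE.
    by rewrite ltr_wpDl ?mulr_ge0.
  have hWV v : qform W v v <= qform V v v.
    rewrite /V mixE !qformDl -[(e * (c * t))%:M]scalemx1 !qformZl lerD2l mulrA -mulrA.
    by rewrite ler_wpM2l// mulr_ge0 ?ltW.
  have dV : definite R m V.
    apply: definite_le hWV; apply: (definiteP _ _ _ _ _ dW) => b; rewrite !mxE.
    by rewrite ltr_wpDl ?mulr_ge0.
  have sV : V^T = V by exact: info_mx_sym.
  have := le_trans (trace_pow_le _ _ _ _ _ p0 (ltW p1) pW sV dV hWV) hV.
  rewrite (spectral_dec_trace_pow _ _ _ _ _ _ dW pn0).
  (* The zero eigenvalue now contributes e^p K; each other term keeps at least the fraction 1 - e,
     because (1 - e)^p >= 1 - e. *)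
  rewrite (bigD1 a)//= !mxE xa0 mulr0 add0r powRM ?(ltW e0) ?(ltW (mulr_gt0 c0 t0))// -/K.
  have hT : (1 - e) * T <= \sum_(i < m | i != a) (\row_b (((1 - e) *: x) 0 b + e * (c * t))) 0 i `^ p.
    rewrite /T (spectral_dec_trace_pow _ _ _ _ _ _ dQ pn0) (bigD1 a)//= xa0 powR0// add0r mulr_sumr.
    apply: ler_sum => i _; rewrite !mxE.
    apply: (@le_trans _ _ (((1 - e) * x 0 i) `^ p)).
      rewrite powRM// ler_wpM2r ?powR_ge0//.
      have [->|fn0] := eqVneq (1 - e) 0; first by exact: powR_ge0.
      apply: ger1_powR; last exact: ltW.
      by rewrite lt_neqAle eq_sym fn0 f0 lerBlDr lerDl ltW.
    by apply: powR_ndecr; rewrite ?(ltW p0) ?mulr_ge0// lerDl ltW.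
  lra.
(* This solves eps^(1-p) = K / (T + K), so eps T = eps^p K T / (T + K) is smaller than eps^p K,
   against [main]. *)
pose eps := (K / (T + K)) `^ (1 - p)^-1.
have TK : 0 < T + K by rewrite ltr_wpDl.
have p10 : 0 < 1 - p by rewrite subr_gt0.
have e0 : 0 < eps by rewrite powR_gt0// divr_gt0.
have e1 : eps <= 1.
  have := powR_ndecr _ (1 - p)^-1 (K / (T + K)) 1; rewrite powR1; apply.
  - by rewrite invr_ge0 ltW.
  - by rewrite divr_ge0 ?ltW.
  - by rewrite ler_pdivrMr// mul1r lerDr.
have ee : eps `^ (1 - p) = K / (T + K).
  by rewrite -powRrM mulVf ?gt_eqF// powRr1// divr_ge0 ?ltW.
have := main eps e0 e1.
have -> : eps * T = eps `^ p * (eps `^ (1 - p) * T).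
  by rewrite mulrA -powRD ?subrKC ?powRr1 ?(ltW e0)// (gt_eqF e0) implybT.
rewrite (ler_pM2l (powR_gt0 p e0)) ee mulrAC ler_pdivlMr// ler_pM2l//.
by apply/negP; rewrite -ltNge ltrDl.
Qed.

(** Removing [e] from one weight leaves a total of at most n - e, and rescaling restores the budget
    n. *)
Lemma feasible_transfer i (e : R) : 0 < e -> e <= w i -> e < n%:R ->
  feasible n (fun j => n%:R / (n%:R - e) * (w j - e * (j == i)%:R)).
Proof.
move=> e0 ei en; case: hw => [[w0 hs] _].
have ne0 : 0 < n%:R - e by rewrite subr_gt0.
have k0 : 0 <= n%:R / (n%:R - e) by rewrite divr_ge0// ltW.
split=> [j|].
  rewrite mulr_ge0//; have [->|_] := eqVneq j i; first by rewrite mulr1 subr_ge0.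
  by rewrite mulr0 subr0.
rewrite -mulr_sumr sumrB -mulr_sumr.
have -> : \sum_j (j == i)%:R = 1 :> R.
  by rewrite (bigD1 i)//= eqxx big1 ?addr0// => j /negbTE ->.
have nz : n%:R - e != 0 by rewrite gt_eqF.
rewrite mulr1 -[leRHS](divfK nz) ler_wpM2l//.
by rewrite lerD2r.
Qed.

Lemma transfer_mxE i (e k : R) :
  info_mx M (fun j => k * (w j - e * (j == i)%:R)) = k *: (X - e *: M i).
Proof.
rewrite -info_mxZ -info_mxB -info_mxZ; congr (_ *: (_ - _ *: _)).
rewrite /info_mx (bigD1 i)//= eqxx scale1r big1 ?addr0// => j /negbTE ->.
by rewrite scale0r.
Qed.

(** Optimality compares [X] with k Z, and concavity with tangent point [Z] bounds [X] from above.
    The gradient thus appears at [Z]; [gradient_bound] then lets e tend to 0. *)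
Lemma gradient_bound_perturbed i (e : R) P z : 0 <= p -> p < 1 ->
  0 < e -> e <= w i / 2 -> definite R m (X - e *: M i) -> spectral_dec (X - e *: M i) P z ->
  trace_pow p X / n%:R <= spectral_trace R m (fun y => y `^ (p - 1)) P z (M i).
Proof.
move=> p0 p1 e0 ei dZ dP; have hopt := proj2 hw.
set Z := X - e *: M i in dZ dP *.
have wi0 := optimal_ge0 i; have win := optimal_le i.
have ew : e <= w i by lra.
have en : e < n%:R by lra.
have ne0 : 0 < n%:R - e by rewrite subr_gt0.
have := hopt _ (feasible_transfer i e e0 ew en); rewrite transfer_mxE -/Z -/X.
set k := n%:R / (n%:R - e); have k0 : 0 < k by exact: divr_gt0.
have sZ : Z^T = Z by rewrite /Z linearB linearZ /= (psdmx_sym _ _ _ optimal_psd) psdmx_sym.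
have pZ : psdmx Z by exact: definite_psd.
have dX := optimal_definite p0 p1.
have z0 a := definite_eigenvalue_gt0 _ _ _ _ _ a dZ dP.
set g := spectral_trace _ _ _ _ _ _.
have XE : X = Z + e *: M i by rewrite /Z subrK.
move: p0; rewrite le_eqVlt => /orP[/eqP p0'|p0].
  have gE : g = spectral_trace R m (fun y => y^-1) P z (M i).
    apply: eq_bigr => a _; rewrite -p0' sub0r powR_inv1// ltW//.
  have pkZ : psdmx (k *: Z).
    apply: definite_psd; last exact: definiteZ.
    by rewrite linearZ /= sZ.
  rewrite -{1 2}p0' => /(Phi0_det_le _ _ m0 _ _ pkZ optimal_psd).
  (* With optimality this gives k^m <= (1 + e g / m)^m, hence k - 1 = e / (n - e) <= e g / m. *)
  have hdet := det_le_spectral_trace _ _ _ _ _ _ optimal_psd dZ dP.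
  move/le_trans => /(_ _ hdet).
  have dZ0 := definite_det_gt0 _ _ _ pZ dZ.
  rewrite detZ mulrC ler_pM2l// XE spectral_traceD spectral_traceZ -gE.
  rewrite (spectral_trace_self _ _ _ _ _ _ dP).
  have -> : \sum_a (z 0 a)^-1 * z 0 a = m%:R.
    rewrite (eq_bigr (fun=> 1)) => [|a _]; last by rewrite mulVf ?gt_eqF.
    by rewrite sumr_const card_ord.
  have mR0 : 0 < m%:R :> R by rewrite ltr0n.
  have g0 : 0 <= g by apply: spectral_trace_ge0 => // y; exact: powR_ge0.
  rewrite ler_pXn2r ?nnegrE ?(ltW k0)//; last by rewrite divr_ge0 ?addr_ge0 ?mulr_ge0 ?(ltW mR0) ?(ltW e0).
  rewrite ler_pdivlMr// /trace_pow -p0' eqxx -XE (definite_rank _ _ _ optimal_psd dX) => hk.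
  rewrite ler_pdivrMr//.
  have kE : k = 1 + e / (n%:R - e) by rewrite /k; field; rewrite gt_eqF.
  move: hk; rewrite kE mulrDl mul1r lerD2l -mulrA ler_pM2l// mulrC ler_pdivrMr// => hk.
  by apply: le_trans hk _; rewrite ler_wpM2l// gerBl ltW.
have pn0 : p != 0 by rewrite gt_eqF.
move/(Phi_trace_pow_le _ _ m0 _ _ _ p0); rewrite (trace_powZ _ _ _ _ _ pZ pn0 (ltW k0)) => hk.
have p01 : 0 <= p <= 1 by rewrite !ltW.
have [Q [x [dQ x0]]] := spectral_dec_psd _ _ _ optimal_psd.
have := trace_power_tangent _ _ _ _ _ _ _ _ _ p01 dP dQ z0 x0.
rewrite -(spectral_dec_trace_pow _ _ _ _ _ _ dQ pn0) -(spectral_dec_trace_pow _ _ _ _ _ _ dP pn0) -/X.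
have -> : X - Z = e *: M i by rewrite XE addrC addKr.
rewrite spectral_traceZ -/g => hKl.
set T := trace_pow p X in hk hKl *; set TZ := trace_pow p Z in hk hKl.
have T0 : 0 <= T by exact: trace_pow_ge0.
(* Concavity at 1 gives k^-p <= 1 - p e / n; together with T <= TZ + p e g this yields T / n <=
   g. *)
have kV : k^-1 `^ p <= 1 + p * (k^-1 - 1).
  have := powR_concave_tangent _ p 1 k^-1 p01 ltr01; rewrite !powR1 mulr1; apply.
  by rewrite invr_ge0 ltW.
have hTZ : TZ <= k^-1 `^ p * T.
  have kk : k^-1 `^ p * k `^ p = 1.
    by rewrite -powRM ?invr_ge0 ?(ltW k0)// mulVf ?powR1// gt_eqF.
  by rewrite -[leLHS]mul1r -kk -mulrA ler_wpM2l// powR_ge0.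
have hTZ' := le_trans hTZ (ler_wpM2r T0 kV).
have kVE : k^-1 = 1 - e / n%:R by rewrite /k; field; rewrite !gt_eqF.
have hfin : p * (e * (T / n%:R)) <= p * (e * g).
  by move: hTZ'; rewrite kVE; move: hKl; lra.
by move: hfin; rewrite ler_pM2l// ler_pM2l.
Qed.

Lemma gradient_bound i Q x : 0 <= p -> p < 1 -> 0 < w i -> spectral_dec X Q x ->
  trace_pow p X / n%:R <= spectral_trace R m (fun y => y `^ (p - 1)) Q x (M i).
Proof.
move=> p0 p1 wi dQ; have [t t0 ht] := optimal_definite p0 p1.
pose kd : R := `|p - 1| * (t / 2) `^ (p - 1 - 1).
have t20 : 0 < t / 2 by lra.
have kd0 : 0 <= kd by rewrite mulr_ge0 ?powR_ge0.
have en0 := entry_norm_ge0 _ _ (M i).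
apply: (@le_of_small_error _ _ _ (m%:R ^+ 2 * (kd * entry_norm R m (M i) * entry_norm R m (M i))) (w i / 2)).
- by lra.
- by apply: mulr_ge0; [exact: exprn_ge0|apply: mulr_ge0 => //; exact: mulr_ge0].
move=> e e0 ei.
have sZ : (X - e *: M i)^T = X - e *: M i.
  by rewrite linearB linearZ /= (psdmx_sym _ _ _ optimal_psd) psdmx_sym.
(* As e <= w_i / 2, removing e M_i leaves at least half of [X], so the spectra stay above t / 2
   uniformly in e. *)
have hZ v : t / 2 * qform 1%:M v v <= qform (X - e *: M i) v v.
  apply: (@le_trans _ _ (2^-1 * qform X v v)).
    by have := ht v; lra.
  rewrite -[X - _]scale1r -transfer_mxE /X !info_mx_form mulr_sumr; apply: ler_sum => j _.
  rewrite mulrA ler_wpM2r ?psdmx_form//; have := optimal_ge0 j.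
  have [->|_] := eqVneq j i; rewrite /= ?mulr1 ?mulr0; lra.
have dZ : definite R m (X - e *: M i) by exists (t / 2).
have [P [z dP]] := spectral_theorem _ _ _ sZ.
apply: le_trans (gradient_bound_perturbed i e P z p0 p1 e0 ei dZ dP) _.
rewrite -lerBlDl; apply: le_trans (ler_norm _) _.
have hk a b : `|divided_difference R (fun y => y `^ (p - 1)) (z 0 a) (x 0 b)| <= kd.
  apply: divided_difference_powR_bound => //; first by rewrite lerBlDr (le_trans (ltW p1)) ?lerDl.
    exact: (spectral_dec_ge _ _ _ _ _ _ _ dP hZ).
  by apply: le_trans (spectral_dec_ge _ _ _ _ _ _ b dQ ht); lra.
apply: le_trans (spectral_trace_lipschitz _ _ _ _ _ _ _ _ _ _ kd dP dQ (psdmx_sym _ _ _ (hM i)) hk) _.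
have -> : X - e *: M i - X = (- e) *: M i by rewrite addrAC subrr add0r scaleNr.
by rewrite entry_normZ normrN (gtr0_norm e0) le_eqVlt; apply/orP; left; apply/eqP; ring.
Qed.

End Optimality.

(** * The linear case p = 1 and the conclusion *)

Lemma trace_pow1 (R : realType) (m : nat) (A : 'M[R]_m) : psdmx A -> trace_pow 1 A = \tr A.
Proof.
move=> pA; have [Q [d [dA d0]]] := spectral_dec_psd _ _ _ pA.
rewrite (spectral_dec_trace_pow _ _ _ _ _ _ dA (oner_neq0 R)).
transitivity (\tr (Q *m A *m Q^T)); last first.
  by rewrite mxtrace_mulC mulmxA (mulmx1C (proj1 dA)) mul1mx.
apply: eq_bigr => a _.
by rewrite -(spectral_dec_eigenvalue _ _ _ _ _ _ dA) powRr1.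
Qed.

Lemma trace_gradient_bound (R : realType) (m s n : nat) (M : 'I_s -> 'M[R]_m)
    (w : 'I_s -> R) i : (0 < m)%N -> (1 <= n)%N -> (forall i, psdmx (M i)) ->
  optimal 1 n M w -> 0 < w i -> \tr (info_mx M w) / n%:R <= \tr (M i).
Proof.
move=> m0 n0 hM hw wi; have hopt := proj2 hw.
have nR0 : 0 < n%:R :> R by rewrite ltr0n.
(* The weight w_i may be all of n; capping at n / 2 keeps n - e positive. *)
pose e := Num.min (w i) (n%:R / 2).
have e0 : 0 < e by rewrite lt_min wi divr_gt0.
have ew : e <= w i by rewrite ge_min lexx.
have en : e < n%:R.
  by apply: (@le_lt_trans _ _ (n%:R / 2)); [rewrite ge_min lexx orbT|lra].
have hf := feasible_transfer _ _ _ _ _ _ _ hw i e e0 ew en.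
have := hopt _ hf => /(Phi_trace_pow_le _ _ m0 _ _ _ ltr01).
rewrite !trace_pow1; last first.
- by apply: info_mx_psd => // j; case: hf.
- by apply: info_mx_psd => // j; case: (proj1 hw).
rewrite transfer_mxE linearZ linearB linearZ /=.
set T := \tr _; set g := \tr _ => h.
have ne0 : 0 < n%:R - e by rewrite subr_gt0.
move: h; rewrite -(ler_pM2l ne0).
have -> : (n%:R - e) * (n%:R / (n%:R - e) * (T - e * g)) = n%:R * (T - e * g).
  by field; rewrite gt_eqF.
by move=> h; rewrite ler_pdivrMr// -(ler_pM2l e0); lra.
Qed.

Lemma trace_pow_gt0 (R : realType) (m : nat) (p : R) (A : 'M[R]_m) : (0 < m)%N ->
  psdmx A -> definite R m A -> 0 < trace_pow p A.
Proof.
move=> m0 pA hA; have [->|pn0] := eqVneq p 0.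
  by rewrite /trace_pow eqxx (definite_rank _ _ _ pA hA) ltr0n.
have [Q [d [dA d0]]] := spectral_dec_psd _ _ _ pA.
rewrite (spectral_dec_trace_pow _ _ _ _ _ _ dA pn0) (bigD1 (Ordinal m0))//=.
rewrite ltr_wpDr ?sumr_ge0// => [i _|]; first exact: powR_ge0.
by rewrite powR_gt0// (definite_eigenvalue_gt0 _ _ _ _ _ _ hA dA).
Qed.

(** For p = 1 an optimal [X] can be singular, so positivity comes from comparison with the uniform
    weights. *)
Lemma optimal_trace_pow_gt0 (R : realType) (m s n : nat) (M : 'I_s -> 'M[R]_m) (p : R)
    (w : 'I_s -> R) : (0 < m)%N -> (1 <= n)%N -> (forall i, psdmx (M i)) ->
  \rank (\sum_(i < s) M i)%R = m -> 0 <= p <= 1 -> optimal p n M w ->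
  0 < trace_pow p (info_mx M w).
Proof.
move=> m0 n0 hM hrank /andP[p0 p1] hw; have pX := optimal_psd _ _ _ _ _ _ _ hM hw.
move: p1; rewrite le_eqVlt => /orP[/eqP p1|p1]; last first.
  by apply: trace_pow_gt0 => //; exact: (optimal_definite _ _ _ _ _ _ _ m0 n0 hM hrank hw).
have hf := feasible_mix _ _ _ _ _ _ _ hw 1 ler01 (lexx 1).
have := proj2 hw _ hf => /(Phi_trace_pow_le _ _ m0 _ _ _ (_ : 0 < p)).
rewrite {1}p1 => /(_ ltr01); apply: lt_le_trans; apply: trace_pow_gt0 => //.
  by apply: info_mx_psd => // i; case: hf.
have -> : info_mx M (fun i => (1 - 1) * w i + 1 * (n%:R / s.+1%:R))
    = (n%:R / s.+1%:R) *: info_mx M (fun=> 1).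
  by rewrite info_mxZ; apply: eq_info_mx => i; rewrite subrr mul0r add0r mul1r mulr1.
apply: definiteZ; first by rewrite divr_gt0 ?ltr0n.
exact: info_mx1_definite.
Qed.

Theorem proposition3p1 (R : realType) (m s N : nat) (M : 'I_s -> 'M[R]_m)
    (p : R) (w : 'I_s -> R) (hm : (0 < m)%N) (hN : (1 <= N)%N)
    (hM : forall i : 'I_s, psdmx (M i))
    (hrank : \rank (\sum_(i < s) M i)%R = m)
    (hp : 0 <= p <= 1)
    (hw : optimal p N M w)
    (S : {set 'I_s}) :
  N%:R^-1 * \sum_(i in S) powRz (w i) (1 - p) <= phi_set p M S / phi p M w.
Proof.
have w0 i : 0 <= w i by case: hw => [[]].
have T0 := optimal_trace_pow_gt0 _ _ _ _ _ _ _ hm hN hM hrank hp hw.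
have pX : psdmx (info_mx M w) by exact: info_mx_psd.
rewrite /phi /phi_set ler_pdivlMr//.
(* Here g_i is the trace of X^(p-1) M_i. Optimality bounds it below where w_i > 0, the tangent
   inequality bounds its weighted sum above, and combining the two gives the claim for every p. *)
suff [g hg hS] : exists2 g : 'I_s -> R,
    forall i, 0 < w i -> trace_pow p (info_mx M w) / N%:R <= g i
  & \sum_(i in S) powRz (w i) (1 - p) * g i <= trace_pow p (\sum_(i in S) M i).
  apply: le_trans hS; rewrite mulrC mulrA mulr_sumr; apply: ler_sum => i _.
  (* The lower bound on g_i is missing where w_i = 0; the convention 0^0 = 0 removes these terms
     even for p = 1. *)
  rewrite mulrC; have [->|wi] := eqVneq (w i) 0; first by rewrite /powRz eqxx !mul0r.
  rewrite ler_wpM2l ?hg// ?lt_neqAle ?w0 ?andbT 1?eq_sym// /powRz (negbTE wi).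
  exact: powR_ge0.
case/andP: hp => p0; rewrite le_eqVlt => /orP[/eqP p1|p1].
  exists (fun i => \tr (M i)) => [i wi|].
    rewrite p1 (trace_pow1 _ _ _ pX).
    by apply: (trace_gradient_bound _ _ _ _ _ _ _ hm hN hM _ wi); rewrite -p1.
  rewrite p1 trace_pow1; last exact: sum_set_psd.
  rewrite linear_sum /=; apply: ler_sum => i _; rewrite subrr /powRz powRr0.
  have tr0 : 0 <= \tr (M i) by rewrite -trace_pow1// trace_pow_ge0.
  by case: ifP; rewrite ?mul0r ?mul1r.
have dX := optimal_definite _ _ _ _ _ _ _ hm hN hM hrank hw p0 p1.
have [Q [x [dQ x0]]] := spectral_dec_psd _ _ _ pX.
exists (fun i => spectral_trace R m (fun y => y `^ (p - 1)) Q x (M i)) => [i wi|].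
  exact: (gradient_bound _ _ _ _ _ _ _ hm hN hM hrank hw).
move: p0; rewrite le_eqVlt => /orP[/eqP p0|p0]; last exact: weighted_trace_le.
rewrite -p0 /trace_pow eqxx; apply: le_trans (weighted_rank_le _ _ _ _ _ S _ _ hM w0 dX dQ).
apply: ler_sum => i _; rewrite subr0 sub0r.
have -> : powRz (w i) 1 = w i by rewrite /powRz; case: eqVneq => // _; rewrite powRr1.
rewrite le_eqVlt; apply/orP; left; apply/eqP; congr (_ * _).
by apply: eq_bigr => a _; rewrite powR_inv1.
Qed.
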